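(* For the reversible Markov chain $(X,P,m)$ there is a constant $C=C(P,m)$ such that $$\frac{l}{C}\le h\le l\cdot D_\Gamma .$$
   Context: Cusped graph. $\Gamma$ is a finitely generated non-elementary group, hyperbolic relative to a finitely generated infinite virtually nilpotent subgroup $H$. $S$ is a finite symmetric generating set of $\Gamma$ such that $S\cap H$ is a symmetric generating set of $H$; $d$ is the word metric of $\mathrm{Cay}(\Gamma,S)$; $\mathbb N=\{1,2,\dots\}$, $\mathbb N_0=\mathbb N\cup\{0\}$; $a>1$ is fixed; $g_H(r)=\#\{h\in H:d(e,h)\le r\}$. The cusped graph $X$ has vertex set $\Gamma\times\mathbb N_0$; $(g,0),(g',0)$ are joined when $g^{-1}g'\in S$; $(g,n),(g',n)$ are joined when $g'\in gH$ and $d(g,g')\le a^n$; $(g,n),(g',n+1)$ are joined when $g'\in gH$ and $d(g,g')\le a^{n+1}$. $\rho_X$ is the graph metric, $B_X$ denotes its balls; $\Gamma$ acts by $g\cdot(g',n)=(gg',n)$ and is identified with $\Gamma\times\{0\}$. The walk. Fix $m_0>0$, $p>1$ and positive sequences $(p_n)_{n\ge0},(q_n)_{n\ge0},(c_n)_{n\ge1}$ with: $\frac1p+\frac{g_H(a)}{p_0g_H(a^2)}=1$; $\frac1{q_{n-1}}+\frac{g_H(a^{n+1})}{p_ng_H(a^{n+2})}\le1$ for $n\ge1$; $\frac{m_0}{p_0g_H(a^2)}=\frac{c_1}{q_0g_H(a)^2}$; $\frac{c_n}{g_H(a^n)p_ng_H(a^{n+2})}=\frac{c_{n+1}}{q_ng_H(a^{n+1})^2}$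 for $n\ge1$; for some $\alpha\ge1$, $\alpha^{-1}\le c_n\le\alpha$, $1<p_n\le\alpha$, $1<q_n\le\alpha$ for $n\ge1$; for some $0<\beta<1$, $\frac{q_{n-1}c_{n+1}g_H(a^n)}{q_nc_ng_H(a^{n+1})}<\beta$ for $n\ge1$. Put $m((g,0))=m_0$, $m((g,n))=c_n/g_H(a^n)$ for $n\ge1$. The transition probabilities $P=(p(x,y))_{x,y\in X}$ are: $p((g,0),(g',0))=\frac1{p\cdot\deg\mathrm{Cay}(\Gamma,S)}$ if $g,g'$ are adjacent in $\mathrm{Cay}(\Gamma,S)$; for $n\ge0$, $g'\in gH$, $d(g,g')\le a^{n+1}$: $p((g,n+1),(g',n))=\frac1{q_ng_H(a^{n+1})}$ and $p((g,n),(g',n+1))=\frac1{p_ng_H(a^{n+2})}$; for $n\ge1$ the remaining probability for a jump starting at $(g,n)$ is distributed among the neighbours of $(g,n)$ in $m^{-1}(\{m((g,n))\})$ in any $\Gamma$-invariant way (for example, uniformly), $(X,P,m)$ being a $\Gamma$-invariant reversible Markov chain: $m(x)p(x,y)=m(y)p(y,x)$ for all $x,y\in X$. Quantities. Let $Y_n$ be the position of the chain at time $n$, $p^{(n)}$ the $n$-step transition probabilities, $\mathbb P_x$ the law of the chain started at $x$, $\mathbb P_m=\sum_xm(x)\mathbb P_x$. The following limits exist and are constant $\mathbb P_m$-almost everywhere: the drift $l=\lim_n\rho_X(Y_0,Y_n)/n$ and the asymptotic entropy $h=\lim_n-\frac1n\log p^{(n)}(Y_0,Y_n)$. $D_\Gamma=\limsup_{n\to\infty}\frac1n\log\#(\Gamma\cap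 B_X(e,n))$ is the critical exponent of $\Gamma$ acting on $(X,\rho_X)$. *)

(* Defs.v *)
From HB Require Import structures.
From mathcomp Require Export all_boot all_order all_algebra.
From mathcomp Require Export finmap.
From mathcomp Require Export all_classical all_reals all_analysis.

Set Implicit Arguments.
Unset Strict Implicit.
Unset Printing Implicit Defensive.

Import Order.TTheory GRing.Theory Num.Theory.
Import numFieldNormedType.Exports.

Local Open Scope classical_set_scope.
Local Open Scope ring_scope.

(** * Graphs *)

Definition joined_by (T : Type) (e : rel T) (x y : T) (n : nat) : Prop :=
  exists p : seq T, [/\ path e x p, last x p = y & size p = n].

Definition graph_connected (T : Type) (e : rel T) : Prop :=
  forall x y, exists n, joined_by e x y n.

(* The value 0 for pairs in distinct components is never used below: all the
   graphs to which [gdist] is applied are connected. *)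
Definition gdist (T : Type) (e : rel T) (x y : T) : nat :=
  match pselect (exists n, `[< joined_by e x y n >]) with
  | left ex => ex_minn ex
  | right _ => 0%N
  end.

(* Gromov's four-point condition on the vertex set. *)
Definition hyperbolic_graph (T : Type) (e : rel T) : Prop :=
  exists delta : nat, forall x y z w : T,
    (gdist e x y + gdist e z w <=
     maxn (gdist e x z + gdist e y w) (gdist e x w + gdist e y z)
     + 2 * delta)%N.

(* Every edge lies on finitely many circuits of each length; here
   [x :: y :: s] lists the successive, pairwise distinct vertices. *)
Definition fine_graph (T : choiceType) (e : rel T) : Prop :=
  forall x y : T, e x y -> forall n : nat,
    finite_set [set s : seq T |
      [/\ size s = n.+1, uniq [:: x, y & s] & cycle e [:: x, y & s]]].

(** * Groups *)

Definition subgroup (G : groupType) (K : set G) : Prop :=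
  K 1%g /\ forall x y, K x -> K y -> K (x * y^-1)%g.

Definition generated_by (G : groupType) (A : set G) : set G :=
  smallest (@subgroup G) A.

Definition finite_index (G : groupType) (K L : set G) : Prop :=
  exists F : set G, finite_set F /\
    forall x, L x -> exists2 t, F t & K (t^-1 * x)%g.

Fixpoint lower_central (G : groupType) (K : set G) (n : nat) : set G :=
  if n is n'.+1 then
    generated_by [set z | exists x y,
      [/\ lower_central K n' x, K y & z = [~ x, y]%g]]
  else K.

Definition nilpotent_subgroup (G : groupType) (K : set G) : Prop :=
  exists n, lower_central K n = [set 1%g].

Definition virtually_nilpotent (G : groupType) (L : set G) : Prop :=
  exists K : set G,
    [/\ subgroup K, K `<=` L, finite_index K L & nilpotent_subgroup K].

(* This includes the finite subgroups ([x = 1]). *)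
Definition virtually_cyclic (G : groupType) (L : set G) : Prop :=
  exists2 x, L x & finite_index (generated_by [set x]) L.

Definition symmetric_generating (G : groupType) (L A : set G) : Prop :=
  (forall x, A x -> A x^-1%g) /\ generated_by A = L.

Definition stabiliser (G : groupType) (V : Type) (act : G -> V -> V) (v : V)
    : set G :=
  [set g | act g v = v].

(* Bowditch's definition: G acts on a connected fine hyperbolic graph with
   finitely many edge orbits and finite edge stabilisers, the infinite vertex
   stabilisers being exactly the conjugates of the infinite subgroup H. *)
Definition relatively_hyperbolic (G : groupType) (H : set G) : Prop :=
  exists (V : choiceType) (e : rel V) (act : G -> V -> V),
    [/\ [/\ symmetric e, irreflexive e, graph_connected e,
            hyperbolic_graph e & fine_graph e],
        [/\ forall v, act 1%g v = v,
            forall g g' v, act (g * g')%g v = act g (act g' v) &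
            forall g u v, e (act g u) (act g v) = e u v],
        exists s : seq (V * V), forall u v, e u v ->
          exists g : G, exists2 f, f \in s & (u, v) = (act g f.1, act g f.2),
        forall u v, e u v ->
          finite_set (stabiliser act u `&` stabiliser act v) &
        (forall v, infinite_set (stabiliser act v) ->
           exists g : G, stabiliser act v = [set x | H (g^-1 * x * g)%g]) /\
        (exists v, stabiliser act v = H)].

(* For G hyperbolic relative to an infinite H, this amounts to the limit set
   of G having more than two points. *)
Definition nonelementary (G : groupType) (H : set G) : Prop :=
  ~ virtually_cyclic [set: G] /\ H <> [set: G].

Definition cusped_pair (G : groupType) (H S : set G) : Prop :=
  [/\ [/\ subgroup H, infinite_set H & virtually_nilpotent H],
      relatively_hyperbolic H, nonelementary H,
      finite_set S /\ symmetric_generating [set: G] S &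
      symmetric_generating H (S `&` H)].

(** * The cusped graph *)

Definition cayley (G : groupType) (S : set G) : rel G :=
  fun g g' => `[< S (g^-1 * g')%g >].

Definition word_dist (G : groupType) (S : set G) (g g' : G) : nat :=
  gdist (cayley S) g g'.

Definition cayley_degree (G : groupType) (S : set G) : nat :=
  #|` fset_set [set g | cayley S 1%g g] |.

Definition growth (R : realType) (G : groupType) (H S : set G) (r : R) : R :=
  (#|` fset_set [set h | H h /\ (word_dist S 1%g h)%:R <= r] |)%:R.

(* [g'] lies in the coset [gH], within distance [r] of [g]. *)
Definition coset_near (R : realType) (G : groupType) (H S : set G) (r : R)
    (g g' : G) : Prop :=
  H (g^-1 * g')%g /\ (word_dist S g g')%:R <= r.

Definition cusp_edge (R : realType) (G : groupType) (H S : set G) (a : R)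
    (x y : G * nat) : Prop :=
  [\/ [/\ x.2 = 0%N, y.2 = 0%N & cayley S x.1 y.1],
      y.2 = x.2 /\ coset_near H S (a ^+ x.2) x.1 y.1 |
      y.2 = x.2.+1 /\ coset_near H S (a ^+ y.2) x.1 y.1].

Definition cusp_adj (R : realType) (G : groupType) (H S : set G) (a : R)
    : rel (G * nat) :=
  fun x y => `[< cusp_edge H S a x y \/ cusp_edge H S a y x >].

Definition cusp_dist (R : realType) (G : groupType) (H S : set G) (a : R)
    (x y : G * nat) : nat :=
  gdist (cusp_adj H S a) x y.

Definition cusp_act (G : groupType) (k : G) (x : G * nat) : G * nat :=
  ((k * x.1)%g, x.2).

(* Limsup in the extended reals of the logarithmic growth rate of the orbit
   of the base point. *)
Definition critical_exponent (R : realType) (G : groupType) (H S : set G)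
    (a : R) : \bar R :=
  limn_esup (fun n : nat =>
    (ln (#|` fset_set [set g : G |
          (cusp_dist H S a (1%g, 0%N) (g, 0%N) <= n)%N] |)%:R / n%:R)%:E).

(** * The walk *)

(* [c 0] is not used. *)
Definition walk_parameters (R : realType) (G : groupType) (H S : set G) (a : R)
    (m0 pp : R) (p q c : nat -> R) : Prop :=
  let gH := growth H S : R -> R in
  [/\ [/\ 0 < m0, 1 < pp, forall n, 0 < p n, forall n, 0 < q n &
          forall n, (1 <= n)%N -> 0 < c n],
      [/\ pp^-1 + gH a / (p 0%N * gH (a ^+ 2)) = 1,
          forall n, (1 <= n)%N ->
            (q n.-1)^-1 + gH (a ^+ n.+1) / (p n * gH (a ^+ n.+2)) <= 1,
          m0 / (p 0%N * gH (a ^+ 2)) = c 1%N / (q 0%N * gH a ^+ 2) &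
          forall n, (1 <= n)%N ->
            c n / (gH (a ^+ n) * p n * gH (a ^+ n.+2)) =
            c n.+1 / (q n * gH (a ^+ n.+1) ^+ 2)],
      exists2 alpha : R, 1 <= alpha & forall n, (1 <= n)%N ->
        [/\ alpha^-1 <= c n <= alpha, 1 < p n <= alpha & 1 < q n <= alpha] &
      exists2 beta : R, 0 < beta < 1 & forall n, (1 <= n)%N ->
        q n.-1 * c n.+1 * gH (a ^+ n) / (q n * c n * gH (a ^+ n.+1)) < beta].

Definition walk_measure (R : realType) (G : groupType) (H S : set G) (a : R)
    (m0 : R) (c : nat -> R) (x : G * nat) : R :=
  if x.2 is n.+1 then c n.+1 / growth H S (a ^+ n.+1) else m0.

Definition walk_transitions (R : realType) (G : groupType) (H S : set G) (a : R)
    (m0 pp : R) (p q c : nat -> R) (P : G * nat -> G * nat -> R) : Prop :=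
  let gH := growth H S : R -> R in
  let m := walk_measure H S a m0 c in
  [/\ (forall x y, 0 <= P x y) /\
        (forall x, \esum_(y in [set: G * nat]) (P x y)%:E = 1%E),
      forall g g', cayley S g g' ->
        P (g, 0%N) (g', 0%N) = (pp * (cayley_degree S)%:R)^-1,
      forall n g g', coset_near H S (a ^+ n.+1) g g' ->
        P (g, n.+1) (g', n) = (q n * gH (a ^+ n.+1))^-1 /\
        P (g, n) (g', n.+1) = (p n * gH (a ^+ n.+2))^-1,
      (* The vertical probabilities being prescribed, what remains goes to the
         neighbours on the same level, on which [m] is constant.  On level 0 no
         such clause is needed: the prescribed values already sum to 1. *)
      forall n g y, (1 <= n)%N -> P (g, n) y != 0 -> cusp_adj H S a (g, n) y &
      (forall k x y, P (cusp_act k x) (cusp_act k y) = P x y) /\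
        (forall x y, m x * P x y = m y * P y x)].

Fixpoint step_prob (R : realType) (X : choiceType) (P : X -> X -> R) (n : nat)
    (x y : X) : R :=
  if n is n'.+1 then
    fine (\esum_(z in [set: X]) (P x z * step_prob P n' z y)%:E)
  else (x == y)%:R.

(* [Y] is, under each [Pr x], a Markov chain with kernel [P] started at [x];
   the state space carries the discrete sigma-algebra. *)
Definition markov_chain (R : realType) (X : choiceType) (P : X -> X -> R)
    (d : measure_display) (Omega : measurableType d)
    (Pr : X -> probability Omega R) (Y : nat -> Omega -> X) : Prop :=
  (forall n (A : set X), measurable (Y n @^-1` A)) /\
  (forall (x : X) (n : nat) (s : nat -> X),
     Pr x [set w | forall i, (i <= n)%N -> Y i w = s i] =
     ((s 0%N == x)%:R * \prod_(i < n) P (s i) (s i.+1))%:E).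

Definition mixture (R : realType) (X : choiceType) (m : X -> R)
    (d : measure_display) (Omega : measurableType d)
    (Pr : X -> probability Omega R) (A : set Omega) : \bar R :=
  (\esum_(x in [set: X]) ((m x)%:E * Pr x A))%E.

Definition is_drift (R : realType) (X : choiceType) (rho : X -> X -> nat)
    (m : X -> R) (d : measure_display) (Omega : measurableType d)
    (Pr : X -> probability Omega R) (Y : nat -> Omega -> X) (l : R) : Prop :=
  {ae mixture m Pr, forall w,
     (fun n : nat => (rho (Y 0%N w) (Y n w))%:R / n%:R) @ \oo --> l}.

Definition is_entropy (R : realType) (X : choiceType) (P : X -> X -> R)
    (m : X -> R) (d : measure_display) (Omega : measurableType d)
    (Pr : X -> probability Omega R) (Y : nat -> Omega -> X) (h : R) : Prop :=
  {ae mixture m Pr, forall w,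
     (fun n : nat => - (n%:R^-1 * ln (step_prob P n (Y 0%N w) (Y n w))))
       @ \oo --> h}.

(* Main.v *)
Require Import Defs.
From mathcomp Require Import ring lra zify.
Import Order.TTheory GRing.Theory Num.Theory.
Set Implicit Arguments.
Unset Strict Implicit.
Unset Printing Implicit Defensive.
Local Open Scope classical_set_scope.
Local Open Scope ring_scope.

(** Starting from [o = (e, 0)], both limits become concentration statements for
    the measures [p^(n)(o, .)].

    Upper bound.  Reversibility and invariance bound the probability of being on
    level k at time n by [m(e, k) / m_0], and [m(e, k)] decays geometrically, so
    up to a small probability the level of [Y_n] stays below a constant K.  The
    points of level at most K in a ball of radius r number at most
    [(K + 1) * #(Gamma cap B(e, r + K))], which gives [h <= l D] as soon as
    [D < oo].  Finiteness of D matters when [l = 0]; it holds because H has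
    polynomial growth for the word metric of Gamma.  Indeed, for a vertex v with
    stabiliser H in Bowditch's graph, geodesics from v to adjacent vertices leave
    v at a bounded angle, so that H is undistorted; and virtually nilpotent
    groups have polynomial growth.

    Lower bound.  Carne's inequality bounds [p^(n)(o, y)] by [C exp(- kappa n)]
    when [rho(o, y) >= l n / 2], with [kappa > 0] depending only on [l > 0];
    hence [h >= kappa].  Since l is determined by P, [C := l / kappa] is a
    legitimate choice. *)

(** * Growth of virtually nilpotent groups *)

(** The cusps are the obstacle to the finiteness of D. An excursion of t steps into a cusp moves by
    up to [t * a ^+ t] inside a coset of H, so balls of H of exponentially large radius have to be
    counted, and polynomial growth is what keeps the count exponential. As [coset_near] measures by
    the metric of Gamma rather than that of H, the nilpotent count alone does not suffice: word
    lengths in H and in Gamma must be compared, and this is what Bowditch's graph is for.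

    The constant has to be fixed before any probability space is given. So both limits are restated
    through [step_prob] alone; two sets that each carry more than half of the mass at time n share a
    point, and this makes the drift a function of the kernel.

    Carne's inequality is proved algebraically. On the points reachable in n steps, conjugation by
    the square root of m turns the kernel into a symmetric contraction; the Chebyshev polynomials of
    such a matrix have entries of modulus at most 1 and move by at most their degree. A free
    parameter z is kept; z = 1 + s, with s proportional to l when l is small, yields kappa. *)

Section WordGrowth.
Variable G : groupType.
Local Open Scope group_scope.
Implicit Types (F : seq G) (x y g h : G) (n k c : nat).

(** Words are positive. A symmetric list of letters still gives the balls of the word metric, and
    only nonnegative powers of a letter have to be pulled out of a word. *)
Definition word_in F n g :=
  exists w : seq G, [/\ (size w <= n)%N, {subset w <= F} & g = \prod_(x <- w) x].

(** The base [n.+2] is at least 2 even for n = 0, so that constant factors can be absorbed into the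
    exponent. *)
Definition poly_growth F := exists A : nat, forall n,
  exists2 s : seq G, (size s <= n.+2 ^ A)%N & forall g, word_in F n g -> g \in s.

Lemma word_in1 F n : word_in F n 1.
Proof. by exists [::]; rewrite big_nil; split. Qed.

Lemma word_in_letter F x : x \in F -> word_in F 1 x.
Proof.
move=> xF; exists [:: x]; split => //; last by rewrite big_seq1.
by move=> y; rewrite inE => /eqP ->.
Qed.

Lemma word_inM F n k g h :
  word_in F n g -> word_in F k h -> word_in F (n + k) (g * h).
Proof.
move=> [w [sw wF ->]] [v [sv vF ->]]; exists (w ++ v); split.
- by rewrite size_cat leq_add.
- by move=> x; rewrite mem_cat => /orP[/wF|/vF].
- by rewrite big_cat.
Qed.

Lemma word_in_mono F F' n k g : (n <= k)%N -> {subset F <= F'} ->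
  word_in F n g -> word_in F' k g.
Proof.
move=> nk FF [w [sw wF ->]]; exists w; split => //.
- exact: leq_trans sw nk.
- by move=> x /wF /FF.
Qed.

(* Since [u ^ x = u * [~ u, x]], conjugating k times by x produces each
   iterated commutator binomially many times. *)
Lemma word_in_conjX F x d k (u : G) :
  iter d (fun v => [~ v, x]) u = 1 ->
  (forall i, (i < d)%N -> iter i (fun v => [~ v, x]) u \in F) ->
  word_in F (k.+1 ^ d) (u ^ (x ^+ k)).
Proof.
elim: k d u => [|k IH] [|d] u ud uF.
- by move: ud => /= ->; rewrite conj1g; exact: word_in1.
- rewrite expg0 conjg1 exp1n; exact: word_in_letter (uF 0%N _).
- by move: ud => /= ->; rewrite conj1g; exact: word_in1.
rewrite expgS conjgM.
have -> : u ^ x = u * [~ u, x] by rewrite commgEl mulVKg.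
rewrite conjMg.
(* The summands are the lengths obtained for [u] and for [[~ u, x]], whose chain of commutators is
   one shorter; they add up to [k.+2 * k.+1 ^ d]. *)
apply: (@word_in_mono F F (k.+1 ^ d.+1 + k.+1 ^ d)) => //.
  by rewrite !expnS -mulSnr leq_mul //; case: (d) => // e; rewrite leq_exp2r.
apply: word_inM; first exact: IH.
apply: IH; first by rewrite -iterSr.
by move=> i id; rewrite -iterSr; apply: uF.
Qed.

(* Reading a word from the left, each occurrence of x is moved to the front by
   [y * x ^+ k = x ^+ k * y ^ (x ^+ k)]. *)
Lemma word_in_pull F F' x M n g :
  (forall y k, y \in F -> (k <= n)%N -> word_in F' M (y ^ (x ^+ k))) ->
  word_in (x :: F) n g ->
  exists a h, [/\ (a <= n)%N, g = x ^+ a * h & word_in F' (n * M) h].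
Proof.
move=> FM [w [sw wF ->]] {g}.
suff [a [h [ale -> wh]]] : exists a h, [/\ (a <= size w)%N,
    \prod_(y <- w) y = x ^+ a * h & word_in F' (size w * M) h].
  exists a, h; split => //; first exact: leq_trans ale sw.
  by apply: word_in_mono wh => //; rewrite leq_mul2r sw orbT.
elim: w sw wF => [|y w IH] /= sw wF.
  by exists 0%N, 1; rewrite big_nil expg0 mulg1; split => //; exact: word_in1.
have [z zw|a [h [ale e wh]]] := IH (ltnW sw).
  by apply: wF; rewrite inE zw orbT.
rewrite big_cons e.
have := wF y (mem_head _ _); rewrite inE => /orP[/eqP ->|yF].
  exists a.+1, h; rewrite expgS mulgA; split => //.
  by apply: word_in_mono wh => //; rewrite mulSn leq_addl.
exists a, (y ^ (x ^+ a) * h); split; first exact: leqW.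
  by rewrite mulgA [y * _]conjgC -mulgA.
rewrite mulSn; apply: word_inM => //.
by apply: FM => //; rewrite (leq_trans ale) // ltnW.
Qed.

(** A word of length n becomes a power of x, with n + 1 possible exponents, times a word of length
    at most [n * n.+1 ^ d] in [F']; the latter length plus 2 is at most [n.+2 ^ d.+1]. *)
Lemma poly_growth_pull F F' x d :
  (forall y k, y \in F -> word_in F' (k.+1 ^ d) (y ^ (x ^+ k))) ->
  poly_growth F' -> poly_growth (x :: F).
Proof.
move=> FF' [A hA]; exists (1 + d.+1 * A)%N => n.
have [s ss hs] := hA (n * n.+1 ^ d)%N.
exists [seq x ^+ a * h | a <- iota 0 n.+1, h <- s].
  rewrite size_allpairs size_iota expnD expn1 leq_mul // (leq_trans ss) //.
  rewrite expnM; case: (A) => // A'; rewrite leq_exp2r // expnS.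
  have h1 : (n.+1 ^ d <= n.+2 ^ d)%N by case: (d) => // e; rewrite leq_exp2r.
  have h2 : (0 < n.+2 ^ d)%N by rewrite expn_gt0.
  by move: h1 h2; move: (n.+1 ^ d)%N (n.+2 ^ d)%N => u v; nia.
have FM y k : y \in F -> (k <= n)%N -> word_in F' (n.+1 ^ d) (y ^ (x ^+ k)).
  move=> yF kn; apply: word_in_mono (FF' y k yF) => //.
  by case: (d) => // e; rewrite leq_exp2r.
move=> g /(word_in_pull FM)[a [h [an -> /hs hh]]].
by apply: (allpairs_f (fun a h => x ^+ a * h)) => //; rewrite mem_iota.
Qed.

Lemma generated_by_incl (A : set G) : A `<=` generated_by A.
Proof. exact: sub_gen_smallest. Qed.

Lemma generated_by_min (A K : set G) : subgroup K -> A `<=` K -> generated_by A `<=` K.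
Proof. by move=> sK AK; apply: smallest_sub. Qed.

Lemma generated_by_subgroup (A : set G) : subgroup (generated_by A).
Proof.
split; first by move=> K [[]].
by move=> x y Ax Ay K [sK AK]; apply: sK.2; [apply: Ax|apply: Ay].
Qed.

(** * Lower central series and growth of nilpotent groups *)

Section Nilpotent.
Variable K : set G.
Hypothesis sK : subgroup K.

Lemma subgroup_mul x y : K x -> K y -> K (x * y).
Proof.
move=> Kx Ky; rewrite -[y]invgK; apply: sK.2 => //.
by rewrite -(mul1g y^-1); apply: sK.2 => //; exact: sK.1.
Qed.

Lemma subgroup_inv x : K x -> K x^-1.
Proof. by move=> Kx; rewrite -(mul1g x^-1); apply: sK.2 => //; exact: sK.1. Qed.

Lemma subgroup_comm x y : K x -> K y -> K [~ x, y].
Proof.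
move=> Kx Ky; rewrite commgEl conjgE.
by do !apply: subgroup_mul => //; apply: subgroup_inv.
Qed.

Lemma lower_central_comm n x y :
  lower_central K n x -> K y -> lower_central K n.+1 [~ x, y].
Proof. by move=> Kx Ky; apply: generated_by_incl; exists x, y. Qed.

Lemma lower_centralS n : lower_central K n.+1 `<=` lower_central K n.
Proof.
elim: n => [|n IH] /=.
  apply: generated_by_min => // z [x [y [Kx Ky ->]]]; exact: subgroup_comm.
apply: smallest_sub; first exact: generated_by_subgroup.
move=> z [x [y [Kx Ky ->]]]; apply: (@lower_central_comm n) => //.
exact: IH.
Qed.

Lemma lower_central_sub n : lower_central K n `<=` K.
Proof. by elim: n => // n IH x /lower_centralS /IH. Qed.

Lemma lower_central_iter_comm n j x y : lower_central K n y -> K x ->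
  lower_central K (n + j) (iter j (fun v => [~ v, x]) y).
Proof.
by move=> Ky Kx; elim: j => [|j IH]; rewrite ?addn0 ?addnS //; apply: lower_central_comm.
Qed.

Lemma lower_central_le n k : (n <= k)%N -> lower_central K k `<=` lower_central K n.
Proof.
move=> /subnK <-; elim: (k - n)%N => [//|j IH] x.
by rewrite addSn => /lower_centralS /IH.
Qed.

(* Removing a letter x of lowest weight adds only commutators of higher weight,
   hence the induction on the weight and, inside it, on the number of letters
   of that weight. *)
Lemma nilpotent_poly_growth F : nilpotent_subgroup K -> {in F, forall x, K x} ->
  poly_growth F.
Proof.
move=> [c Kc].
suff key i : (i <= c)%N -> forall F, {in F, forall x, lower_central K (c - i) x} ->
    poly_growth F.
  by move=> FK; apply: (key c) => // x; rewrite subnn; exact: FK.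
elim: i => [_ {}F FK|i IH ic {}F FK].
  have F1 : {in F, forall x, x = 1} by move=> x /FK; rewrite subn0 Kc.
  exists 1%N => n; exists [:: 1]; first by rewrite expn1.
  move=> g [w [_ wF ->]]; rewrite big_seq big1 ?inE // => x /wF; exact: F1.
suff main s t : {in s, forall x, lower_central K (c - i.+1) x} ->
    {in t, forall x, lower_central K (c - i) x} -> poly_growth (s ++ t).
  by have := main F [::] FK; rewrite cats0; apply.
have ci : (c - i = (c - i.+1).+1)%N by rewrite subnSK.
elim: s t {F FK} => [|x s IHs] t sK' tK; first exact: IH (ltnW ic) _ tK.
have Kx : K x by apply: (@lower_central_sub (c - i.+1)); apply: sK'; rewrite inE eqxx.
have stK y : y \in s ++ t -> lower_central K (c - i.+1) y.
  rewrite mem_cat => /orP[ys|yt]; first by apply: sK'; rewrite inE ys orbT.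
  by apply: lower_centralS; rewrite -ci; apply: tK.
(* Commutators of order 1 to c suffice: the one of order [c.+1] has weight at least c, hence is
   trivial. All of them have higher weight than x, so the list [s] of letters of lowest weight does
   not grow. *)
pose t' := t ++ [seq iter j.+1 (fun v => [~ v, x]) y | j <- iota 0 c, y <- s ++ t].
apply: (@poly_growth_pull _ (s ++ t') x c.+1).
  move=> y k yst; apply: word_in_conjX.
    have := lower_central_iter_comm c.+1 (stK y yst) Kx.
    by move=> /(@lower_central_le c)-/(_ _); rewrite Kc; apply; lia.
  case=> [_|j jc] /=.
    by move: yst; rewrite !mem_cat => /orP[->|->] //; rewrite orbT.
  rewrite !mem_cat; apply/orP; right; apply/orP; right.
  apply: (allpairs_f (fun j y => iter j.+1 (fun v => [~ v, x]) y)) => //.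
  by rewrite mem_iota.
apply: IHs => [z zs|z]; first by apply: sK'; rewrite inE zs orbT.
rewrite mem_cat => /orP[/tK //|/allpairsP [[j y] /= [_ yst ->]]].
rewrite ci; apply: (@lower_central_le _ (c - i.+1 + j.+1)); first by lia.
exact: (lower_central_iter_comm j.+1 (stK y yst) Kx).
Qed.
End Nilpotent.

(* Schreier rewriting: [f * t = t' * k] with [t, t'] in a transversal. *)
Lemma virtually_nilpotent_poly_growth (L : set G) F : subgroup L ->
  virtually_nilpotent L -> {in F, forall x, L x} -> poly_growth F.
Proof.
move=> sL [K [sK KL [T [Tfin hT]] nK]] FL.
have [t ht] : {t : G -> G & forall x, L x -> T (t x) /\ K ((t x)^-1 * x)}.
  apply: (boolp.choice (P := fun x tx => L x -> T tx /\ K (tx^-1 * x))) => x.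
  by have [/hT[y Ty Ky]|nL] := pselect (L x); [exists y|exists 1].
have Lt x : L x -> L (t x).
  move=> Lx; have [_ Kx] := ht x Lx.
  rewrite -[t x]invgK -(mulgK x (t x)^-1) invgM invgK; apply: subgroup_mul => //.
  by apply: subgroup_inv => //; apply: KL.
pose Ts := fset_set T.
pose F' := [seq z <- [seq u^-1 * p.1 * p.2 | u <- Ts, p <- [seq (f, v) | f <- F, v <- Ts]] | `[< K z >]].
have tTs x : L x -> t x \in Ts by move=> /ht[Tx _]; rewrite in_fset_set // inE.
have [z|A hA] := @nilpotent_poly_growth K sK F' nK.
  by rewrite mem_filter => /andP[/asboolP].
exists (size Ts + A)%N => n; have [s ss hs] := hA n.
(* The representative [t 1] of the trivial coset may differ from 1, whence the correction on the
   right. *)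
exists [seq u * z * (t 1)^-1 | u <- Ts, z <- s].
  rewrite size_allpairs expnD leq_mul //.
  by rewrite ltnW // (leq_trans (ltn_expl _ (ltnSn 1))) //; case: (size Ts) => // e; rewrite leq_exp2r.
move=> g [w [sw wF ->]] {g}.
suff [wL wF'] : L (\prod_(x <- w) x) /\
    word_in F' (size w) ((t (\prod_(x <- w) x))^-1 * \prod_(x <- w) x * t 1).
  apply/allpairsP; exists (t (\prod_(x <- w) x),
     (t (\prod_(x <- w) x))^-1 * \prod_(x <- w) x * t 1); split => /=.
  - exact: tTs.
  - by apply: hs; apply: word_in_mono wF'.
  - by rewrite !mulgA mulgV mul1g mulgK.
elim: w {sw} wF => [|f w IH] wF.
  by rewrite big_nil mulg1 mulVg; split; [exact: sL.1|exact: word_in1].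
have [z zw|wL wF'] := IH; first by apply: wF; rewrite inE zw orbT.
have fF : f \in F by apply: wF; rewrite mem_head.
rewrite big_cons; set g := \prod_(x <- w) x in wL wF' *.
have Lfg : L (f * g) by apply: subgroup_mul => //; apply: FL.
split => //.
have -> : (t (f * g))^-1 * (f * g) * t 1 =
   ((t (f * g))^-1 * f * t g) * ((t g)^-1 * g * t 1).
  by rewrite !mulgA mulgK.
apply: (@word_inM F' 1) => //; apply: word_in_letter.
rewrite mem_filter; apply/andP; split.
  apply/asboolP.
  have -> : (t (f * g))^-1 * f * t g = ((t (f * g))^-1 * (f * g)) * ((t g)^-1 * g)^-1.
    by rewrite invgM invgK !mulgA mulgK.
  by apply: sK.2; [exact: (ht _ Lfg).2|exact: (ht _ wL).2].
apply/allpairsP; exists (t (f * g), (f, t g)); split => //=; first exact: tTs.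
by apply/allpairsP; exists (f, t g); split => //=; exact: tTs.
Qed.

End WordGrowth.

(** * Geodesics issuing from a vertex of a fine hyperbolic graph *)

Section GraphDistance.
Variables (T : eqType) (e : rel T).
Implicit Types (x y z : T) (n k : nat).

Lemma joined_by0 x : joined_by e x x 0.
Proof. by exists [::]; split. Qed.

Lemma joined_by1 x y : e x y -> joined_by e x y 1.
Proof. by move=> xy; exists [:: y]; rewrite /= xy; split. Qed.

Lemma joined_by_trans x y z n k :
  joined_by e x y n -> joined_by e y z k -> joined_by e x z (n + k).
Proof.
move=> [p [ep lp <-]] [r [er lr <-]]; exists (p ++ r).
by rewrite cat_path last_cat lp size_cat ep; split.
Qed.

Lemma joined_by_sym x y n : symmetric e -> joined_by e x y n -> joined_by e y x n.
Proof.
move=> esym [p [ep <- <-]]; exists (rev (belast x p)); split.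
- by rewrite rev_path; under eq_path => a b do rewrite esym.
- by case: p {ep} => //= a p; rewrite rev_cons last_rcons.
- by rewrite size_rev size_belast.
Qed.

Lemma gdist_le x y n : joined_by e x y n -> (gdist e x y <= n)%N.
Proof.
move=> j; rewrite /gdist; case: pselect => // ex.
by case: ex_minnP => m _ /(_ n); apply; apply/asboolP.
Qed.

Lemma gdist_joined x y n : joined_by e x y n -> joined_by e x y (gdist e x y).
Proof.
move=> j; rewrite /gdist; case: pselect => [ex|]; last by case; exists n; apply/asboolP.
by case: ex_minnP => m /asboolP.
Qed.

Lemma gdistxx x : gdist e x x = 0%N.
Proof. by apply/eqP; rewrite -leqn0; apply: gdist_le; exact: joined_by0. Qed.

Lemma gdist_sym x y : symmetric e -> gdist e x y = gdist e y x.
Proof.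
move=> esym; have [[n j]|nj] := pselect (exists n, joined_by e x y n).
  apply/eqP; rewrite eqn_leq; apply/andP; split; apply: gdist_le; apply: joined_by_sym => //.
  - exact: gdist_joined (joined_by_sym esym j).
  - exact: gdist_joined j.
rewrite /gdist; case: pselect => [ex|_].
  by case: nj; case: ex => n /asboolP j; exists n.
case: pselect => // ex; case: nj; case: ex => n /asboolP j; exists n.
exact: joined_by_sym.
Qed.

Hypothesis esym : symmetric e.
Hypothesis econn : graph_connected e.

Lemma gdistP x y : joined_by e x y (gdist e x y).
Proof. by have [n] := econn x y; apply: gdist_joined. Qed.

Lemma gdist_triangle y x z : (gdist e x z <= gdist e x y + gdist e y z)%N.
Proof. by apply: gdist_le; apply: joined_by_trans; apply: gdistP. Qed.

Lemma gdist_eq0 x y : gdist e x y = 0%N -> x = y.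
Proof. by move=> d0; have := gdistP x y; rewrite d0 => -[[|a p] [_ <-]]. Qed.

Lemma geodesic_split x y p z : path e x p -> last x p = y -> z \in x :: p ->
  exists i, [/\ (i <= size p)%N, joined_by e x z i & joined_by e z y (size p - i)].
Proof.
move=> ep lp zp; case/splitPl: zp ep lp => p1 p2 lz; rewrite cat_path last_cat lz.
move=> /andP[e1 e2] l2; exists (size p1); rewrite size_cat leq_addr addKn.
by split => //; [exists p1|exists p2].
Qed.

End GraphDistance.

Definition avoiding (T : eqType) (e : rel T) (v : T) : rel T :=
  [rel x y | [&& e x y, x != v & y != v]].

Lemma path_avoiding (T : eqType) (e : rel T) v x p :
  path e x p -> v \notin x :: p -> path (avoiding e v) x p.
Proof.
elim: p x => //= y p IH x /andP[exy ep].
rewrite !inE !negb_or => /and3P[vx vy vp].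
apply/andP; split; first by rewrite /avoiding /= exy eq_sym vx eq_sym.
by apply: IH => //; rewrite inE negb_or vy.
Qed.

Lemma avoiding_sym (T : eqType) (e : rel T) v : symmetric e -> symmetric (avoiding e v).
Proof. by move=> es x y; rewrite /avoiding /= es; congr (_ && _); rewrite andbC.
Qed.

Section Fan.
Variables (V : choiceType) (e : rel V).
Hypotheses (esym : symmetric e) (eirr : irreflexive e) (econn : graph_connected e).
Variable delta : nat.
Hypothesis hyp : forall x y z w : V,
    (gdist e x y + gdist e z w <=
     maxn (gdist e x z + gdist e y w) (gdist e x w + gdist e y z)
     + 2 * delta)%N.
Variable v : V.
Let d := gdist e.

(** The neighbour u serves as a direction at v in which x is seen; there may be several for one
    x. *)
Definition starts_geodesic x u :=
  e v u /\ exists2 n, joined_by e u x n & d v x = n.+1.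

Lemma starts_geodesic_exists x : x <> v -> exists u, starts_geodesic x u.
Proof.
move=> xv; have [[|u p] [ep lp sp]] := gdistP econn v x; first by case: xv.
move: ep => /= /andP[evu ep]; exists u; split => //.
by exists (size p); [exists p|rewrite /d -sp].
Qed.

Lemma starts_geodesic_nbr x : e v x -> starts_geodesic x x.
Proof.
move=> vx; split => //; exists 0%N; first exact: joined_by0.
apply/eqP; rewrite eqn_leq (gdist_le (joined_by1 vx)) lt0n.
by apply/eqP => /(gdist_eq0 econn) vE; move: vx; rewrite vE eirr.
Qed.

(** The point y is the one at distance k + 1 from v on the geodesic. A geodesic does not return to
    its origin, so its part from u to y avoids v. *)
Lemma starts_geodesic_cut x u k : starts_geodesic x u ->
  (k < d v x)%N -> exists y,
  [/\ joined_by (avoiding e v) u y k, d v y = k.+1 & (d y x = d v x - k.+1)%N].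
Proof.
move=> [vu [n [p [ep lp sp]] dx]]; rewrite /d in dx; rewrite /d dx ltnS => kn.
exists (last u (take k p)).
have ek : path e u (take k p) by rewrite -[p](cat_take_drop k) cat_path in ep; case/andP: ep.
have sk : size (take k p) = k by rewrite size_takel // sp.
have far z i : joined_by e z x i -> (n.+1 - i <= d v z)%N.
  move=> /gdist_le zx; rewrite leq_subLR -dx.
  by rewrite (leq_trans (gdist_triangle econn z v x)) // addnC leq_add2r.
have jx : joined_by e (last u (take k p)) x (n - k).
  exists (drop k p); rewrite size_drop sp; split => //.
    by rewrite -[p](cat_take_drop k) cat_path in ep; case/andP: ep.
  by rewrite -lp -[in RHS](cat_take_drop k p) last_cat.
have dvk : (d v (last u (take k p)) <= k.+1)%N.
  have jk : joined_by e u (last u (take k p)) k by exists (take k p).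
  by have := gdist_le (joined_by_trans (joined_by1 vu) jk); rewrite add1n.
have := far _ _ jx; rewrite subSn ?leq_subr // subKn // => dvk'.
split.
- exists (take k p); split => //; apply: path_avoiding => //; apply/negP => vp.
  have vp' : v \in u :: p.
    move: vp; rewrite !inE => /orP[->//|/mem_take ->]; exact: orbT.
  have [i [ile _ j2]] := geodesic_split ep lp vp'.
  by have := far _ _ j2; rewrite /d gdistxx sp subSn ?leq_subr.
- by apply/eqP; rewrite eqn_leq dvk.
- apply/eqP; rewrite eqn_leq subSS (gdist_le jx) /= leq_subLR -ltnS -addSn -dx.
  by rewrite (leq_trans (gdist_triangle econn (last u (take k p)) v x)) // leq_add2r.
Qed.

(** A bounded angle at v in Bowditch's sense. The bound leaves room for three paths of at most
    [2 * delta + 2] steps: out along one geodesic, across, and back along the other. *)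
Definition near_nbrs u u' :=
  [/\ e v u, e v u' &
      exists2 n, (n <= 6 * delta + 9)%N & joined_by (avoiding e v) u u' n].

(* Geodesics from v to adjacent points are still close to each other at
   distance [2 * delta + 3] from v, where a short path joining them has to
   avoid v. *)
Lemma near_nbrs_starts x x' u u' : (x = x' \/ e x x') -> x <> v -> x' <> v ->
  starts_geodesic x u -> starts_geodesic x' u' -> near_nbrs u u'.
Proof.
move=> xx' xv xv' ux ux'; split; [by case: ux|by case: ux'|].
have dxx' : (d x x' <= 1)%N.
  by case: xx' => [->|/joined_by1/gdist_le //]; rewrite /d gdistxx.
have t1 := gdist_triangle econn x v x'; have t2 := gdist_triangle econn x' v x.
have pos z : z <> v -> (0 < d v z)%N.
  by move=> zv; rewrite lt0n; apply/eqP => /(gdist_eq0 econn) vz; case: zv.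
have sx := gdist_sym x' x esym.
rewrite -/d in t1 t2 sx.
have asym := avoiding_sym v esym.
have [big|] := boolP ((2 * delta + 3 <= d v x) && (2 * delta + 3 <= d v x'))%N.
  case/andP: big => big big'.
  have [|y [uy vy yx]] := @starts_geodesic_cut x u (2 * delta + 2) ux; first by lia.
  have [|y' [uy' vy' yx']] := @starts_geodesic_cut x' u' (2 * delta + 2) ux'; first by lia.
  (* Four-point condition for y, y', v, x: since x and x' are at distance at most 1, both sums on
     its right-hand side are at most [d v x + 2]. *)
  have yy' : (d y y' <= 2 * delta + 2)%N.
    have := hyp y y' v x; have := gdist_triangle econn x' y' x.
    have := gdist_sym y v esym; have := gdist_sym y' v esym.
    rewrite -/d; lia.
  have [p [ep lp sp]] := gdistP econn y y'.
  exists (2 * delta + 2 + (d y y' + (2 * delta + 2)))%N; first by lia.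
  apply: joined_by_trans uy _; apply: joined_by_trans; last exact: joined_by_sym uy'.
  exists p; split => //; apply: path_avoiding => //; apply/negP => vp.
  have [i [ile j1 j2]] := geodesic_split ep lp vp.
  have := gdist_le j1; rewrite gdist_sym // -/d vy.
  by move: ile; rewrite sp -/d; lia.
(* One of x, x' is within [2 * delta + 2] of v: both geodesics are short, and together with the edge
   between x and x' they form the path themselves. *)
rewrite negb_and -!ltnNge => small.
have px := pos _ xv; have px' := pos _ xv'.
have [|y [uy vy yx]] := @starts_geodesic_cut x u (d v x).-1 ux; first by lia.
have [|y' [uy' vy' yx']] := @starts_geodesic_cut x' u' (d v x').-1 ux'; first by lia.
have {}yx : y = x by apply: (gdist_eq0 econn); rewrite -/d yx; lia.
have {}yx' : y' = x' by apply: (gdist_eq0 econn); rewrite -/d yx'; lia.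
subst y y'.
have [n n1 jn] : exists2 n, (n <= 1)%N & joined_by (avoiding e v) x x' n.
  case: xx' => [<-|exx']; first by exists 0%N => //; exact: joined_by0.
  by exists 1%N => //; apply: joined_by1; apply/and3P; split => //; apply/eqP.
exists ((d v x).-1 + (n + (d v x').-1))%N; first by lia.
apply: joined_by_trans uy _; apply: joined_by_trans; first exact: jn.
exact: joined_by_sym.
Qed.

(** A detour from u to u' avoiding v, made simple and closed up through v, is a circuit of bounded
    length containing the edge from v to u; fineness leaves finitely many of these. *)
Lemma near_nbrs_finite u : fine_graph e -> finite_set [set u' | near_nbrs u u'].
Proof.
move=> fine; have [vu|nvu] := boolP (e v u); last first.
  apply: (@sub_finite_set _ _ set0); last exact: finite_set0.
  by move=> u' [vu]; rewrite vu in nvu.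
apply: (@sub_finite_set _ _ ([set u] `|`
  \bigcup_(n in `I_(6 * delta + 9)) (last u @` [set s : seq V |
      [/\ size s = n.+1, uniq [:: v, u & s] & cycle e [:: v, u & s]]]))).
  move=> u' [_ vu' [n nM [p [ep lp sp]]]].
  have [<-|uu'] := eqVneq u u'; first by left.
  right; move: lp; case/shortenP: ep => p' ep' up' pp' lp'.
  have sp' : (size p' <= size p)%N.
    by apply: uniq_leq_size; [case/andP: up'|].
  have p'0 : (0 < size p')%N by case: (p') lp' uu' => //= ->; rewrite eqxx.
  exists (size p').-1; first by rewrite /= prednK // (leq_trans sp') // sp.
  exists p' => //; split; first by rewrite prednK.
    rewrite /= in up' *; rewrite up' andbT inE negb_or; apply/andP; split.
      by apply/eqP => vE; move: vu; rewrite -vE eirr.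
    apply/negP => vp'.
    have : all (fun z => z != v) p'.
      elim: p' u ep' {up' pp' lp' sp' p'0 vp' vu uu'} => //= z p' IH u.
      by move=> /andP[/and3P[_ _ ->] /IH].
    by move=> /allP/(_ _ vp'); rewrite eqxx.
  rewrite /= vu rcons_path lp' esym vu' andbT /=.
  by apply: sub_path ep' => a b /and3P[].
rewrite finite_setU; split; first exact: finite_set1.
apply: bigcup_finite; first exact: finite_II.
by move=> n _; apply: finite_image; exact: fine.
Qed.

End Fan.

(** * Peripheral subgroups are undistorted *)

Section VertexStabiliser.
Variables (G : groupType) (V : choiceType) (e : rel V) (act : G -> V -> V).
Hypotheses (esym : symmetric e) (eirr : irreflexive e) (econn : graph_connected e).
Hypothesis fine : fine_graph e.
Variable delta : nat.
Hypothesis hyp : forall x y z w : V,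
    (gdist e x y + gdist e z w <=
     maxn (gdist e x z + gdist e y w) (gdist e x w + gdist e y z)
     + 2 * delta)%N.
Hypothesis act1 : forall v, act 1%g v = v.
Hypothesis actM : forall g g' v, act (g * g')%g v = act g (act g' v).
Hypothesis acte : forall g u v, e (act g u) (act g v) = e u v.
Hypothesis edge_orbits : exists s : seq (V * V), forall u v, e u v ->
  exists g : G, exists2 f, f \in s & (u, v) = (act g f.1, act g f.2).
Hypothesis edge_stab : forall u v, e u v ->
  finite_set (stabiliser act u `&` stabiliser act v).
Variable v : V.
Let H := stabiliser act v.

Lemma actK g u : act g^-1%g (act g u) = u.
Proof. by rewrite -actM mulVg act1. Qed.

Lemma actKV g u : act g (act g^-1%g u) = u.
Proof. by rewrite -actM mulgV act1. Qed.

Definition cofinite (A : V -> V -> Prop) := exists s : seq (V * V),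
  (forall p, p \in s -> e v p.1 /\ e v p.2) /\
  forall u u', A u u' -> exists h, exists2 p, p \in s &
    H h /\ (u, u') = (act h p.1, act h p.2).

Lemma cofiniteU A B : cofinite A -> cofinite B -> cofinite (fun u u' => A u u' \/ B u u').
Proof.
move=> [s [se sA]] [t [te tB]]; exists (s ++ t); split.
  by move=> p; rewrite mem_cat => /orP[/se|/te].
move=> u u' [/sA|/tB] [h [p pp [Hh E]]]; exists h, p => //;
  by rewrite mem_cat pp ?orbT.
Qed.

Lemma act_same_vertex g g0 u : act g u = v -> act g0 u = v -> H (g * g0^-1)%g.
Proof. by move=> gu g0u; rewrite /H /stabiliser /= actM -{1}g0u actK. Qed.

(** Two elements of G carrying the same vertex to v differ by an element of H, so each G-orbit of
    oriented edges contributes at most one H-orbit of edges leaving v. *)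
Lemma nbr_orbits : exists W : seq V, (forall w, w \in W -> e v w) /\
  forall u, e v u -> exists h, exists2 w, w \in W & H h /\ u = act h w.
Proof.
have [s hs] := edge_orbits.
pose rep (f : V * V) : option V :=
  match pselect (exists g, act g f.1 = v) with
  | left ex => Some (act (projT1 (cid ex)) f.2) | right _ => None end.
exists [seq w <- pmap rep s | e v w]; split; first by move=> w; rewrite mem_filter => /andP[].
move=> u vu; have [g [f fs [gv gu]]] := hs v u vu.
have : rep f <> None by rewrite /rep; case: pselect => // -[]; exists g.
case E : (rep f) => [w|//] _.
move: (E); rewrite /rep; case: pselect => // ex [].
case: (cid ex) => g0 /= g0v wE.
have Hg : H (g * g0^-1)%g by apply: act_same_vertex g0v.
have uE : u = act (g * g0^-1)%g w by rewrite -wE actM actK.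
exists (g * g0^-1)%g, w => //.
rewrite mem_filter mem_pmap; apply/andP; split; last by rewrite -E map_f.
by rewrite -(acte (g * g0^-1)%g) -uE Hg.
Qed.

Lemma act_near_nbrs h u u' : H h ->
  near_nbrs e delta v u u' -> near_nbrs e delta v (act h u) (act h u').
Proof.
move=> Hh [vu vu' [n nM [p [ep lp sp]]]].
split; [by rewrite -{1}Hh acte|by rewrite -{1}Hh acte|].
exists n => //; exists (map (act h) p); split; last by rewrite size_map.
  have avh z z' : avoiding e v (act h z) (act h z') = avoiding e v z z'.
    have av y : (act h y == v) = (y == v).
      by apply/eqP/eqP => [hy|->//]; rewrite -(actK h y) hy -{1}Hh actK.
    by rewrite /avoiding /= acte !av.
  elim: p u ep {vu lp sp} => //= z p IH u /andP[uz zp].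
  by apply/andP; split; [rewrite avh|exact: IH].
by rewrite last_map lp.
Qed.

Lemma cofinite_near_nbrs : cofinite (near_nbrs e delta v).
Proof.
have [W [We hW]] := nbr_orbits.
pose N w := fset_set [set u' | near_nbrs e delta v w u'].
have Nfin w : finite_set [set u' | near_nbrs e delta v w u'].
  exact: near_nbrs_finite.
exists [seq (w, u') | w <- W, u' <- N w]; split.
  move=> p /allpairsPdep[w [u' [wW]]]; rewrite in_fset_set // inE => -[vw vu' _] -> //.
move=> u u' uu'.
have [vu _ _] := uu'; have [h [w wW [Hh uE]]] := hW u vu.
exists h, (w, act h^-1%g u'); last by rewrite /= actKV uE.
apply/allpairsPdep; exists w, (act h^-1%g u'); split => //.
rewrite in_fset_set // inE /=.
rewrite -(actK h w) -uE; apply: act_near_nbrs => //.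
by rewrite /H /stabiliser /= -{1}Hh actK.
Qed.

(* Where a path passes through v, no detour avoiding v bounds the angle; one uses
   that its turns are translates of finitely many two-edge paths. *)
Definition translated_turn (t : seq (V * V * V)) u u' :=
  exists g, exists2 x, x \in t & [/\ act g x.1.1 = u, act g x.1.2 = v, act g x.2 = u',
    e v u & e v u'].

Lemma cofinite_turn t : cofinite (translated_turn t).
Proof.
pose rep (x : V * V * V) : option (V * V) :=
  match pselect (exists g, act g x.1.2 = v) with
  | left ex => Some (act (projT1 (cid ex)) x.1.1, act (projT1 (cid ex)) x.2)
  | right _ => None end.
exists [seq p <- pmap rep t | e v p.1 && e v p.2]; split.
  by move=> p; rewrite mem_filter => /andP[/andP[]].
move=> u u' [g [x xt [gu gv gu' vu vu']]].
have : rep x <> None by rewrite /rep; case: pselect => // -[]; exists g.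
case E : (rep x) => [p|//] _.
move: (E); rewrite /rep; case: pselect => // ex [].
case: (cid ex) => g0 /= g0v pE.
have Hg : H (g * g0^-1)%g by apply: act_same_vertex g0v.
have uE : u = act (g * g0^-1)%g p.1 by rewrite -pE /= actM actK.
have uE' : u' = act (g * g0^-1)%g p.2 by rewrite -pE /= actM actK.
exists (g * g0^-1)%g, p; last by rewrite -uE -uE'.
rewrite mem_filter mem_pmap; apply/andP; split; last by rewrite -E map_f.
by rewrite -(acte (g * g0^-1)%g v) -(acte (g * g0^-1)%g v) -uE -uE' Hg vu.
Qed.

Lemma stab_subgroup : subgroup H.
Proof.
split; first exact: act1.
by move=> x y Hx Hy; rewrite /H /stabiliser /= actM -{1}Hy actK.
Qed.

(** The set is empty or a left coset of an edge stabiliser. *)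
Lemma transporter_finite a b : e v a -> finite_set [set k | H k /\ act k a = b].
Proof.
move=> va; have [[k0 [Hk0 k0a]]|no] := pselect (exists k, H k /\ act k a = b); last first.
  by apply: (@sub_finite_set _ _ set0) => // k kk; case: no; exists k.
apply: (@sub_finite_set _ _ ((fun k => k0 * k)%g @` (stabiliser act v `&` stabiliser act a))).
  move=> k [Hk ka]; exists (k0^-1 * k)%g; last by rewrite mulVKg.
  split; last by rewrite /stabiliser /= actM ka -k0a actK.
  exact: (subgroup_mul stab_subgroup (subgroup_inv stab_subgroup Hk0) Hk).
by apply: finite_image; apply: edge_stab.
Qed.

Lemma cofinite_chain A u0 : cofinite A -> e v u0 -> exists F : seq G,
  (forall x, x \in F -> H x) /\
  forall n h, H h -> joined_by (fun u u' => `[< A u u' >]) u0 (act h u0) n ->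
    word_in F n.+1 h.
Proof.
move=> [s [se sA]] vu0.
pose W := u0 :: map fst s ++ map snd s.
have We w : w \in W -> e v w.
  rewrite inE mem_cat => /or3P[/eqP -> //|/mapP[p /se[]? ? -> //]|/mapP[p /se[]? ? -> //]].
pose F := [seq k <- flatten [seq enum_fset (fset_set [set k | H k /\ act k p.1 = p.2])
   | p <- [seq (a, b) | a <- W, b <- W]] | `[< H k >]].
exists F; split; first by move=> x; rewrite mem_filter => /andP[/asboolP].
have FP k a b : H k -> a \in W -> b \in W -> act k a = b -> k \in F.
  move=> Hk aW bW kab; rewrite mem_filter; apply/andP; split; first exact/asboolP.
  apply/flatten_mapP; exists (a, b); first exact: allpairs_f.
  by rewrite in_fset_set ?inE //=; apply: transporter_finite; exact: We.
move=> n h Hh [p [ep lp sp]].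
suff key : exists h' b, [/\ H h', word_in F n h', b \in W & act h' b = act h u0].
  have [h' [b [Hh' wh' bW hb]]] := key.
  rewrite -(mulVKg h' h) -addn1; apply: word_inM => //; apply: word_in_letter.
  apply: (FP _ u0 b) => //; rewrite ?inE ?eqxx //; last by rewrite actM -hb actK.
  exact: (subgroup_mul stab_subgroup (subgroup_inv stab_subgroup Hh') Hh).
rewrite -lp -sp; elim/last_ind: p ep {lp sp} => [|p x IH].
  move=> _; exists 1%g, u0; rewrite act1 inE eqxx; split => //.
  exact: word_in1.
rewrite rcons_path last_rcons size_rcons => /andP[/IH [h' [b [Hh' wh' bW hb]]]].
move=> /asboolP /sA [k [q qs [Hk [lE xE]]]].
have q1 : q.1 \in W by rewrite inE mem_cat map_f // orbT.
have q2 : q.2 \in W by rewrite inE mem_cat (map_f snd) // !orbT.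
have Hf : H (h'^-1 * k)%g.
  exact: (subgroup_mul stab_subgroup (subgroup_inv stab_subgroup Hh') Hk).
exists k, q.2; split => //.
rewrite -(mulVKg h' k) -addn1; apply: word_inM => //; apply: word_in_letter.
by apply: (FP _ q.1 b) => //; rewrite actM -lE -hb actK.
Qed.

(** Discarding the endpoint v lets an edge at v be seen too, namely through its other end. The roles
    of x and y are symmetric, so that orientation does not matter. *)
Definition seen_along x y u :=
  exists z, [/\ z = x \/ z = y, z <> v & starts_geodesic e v z u].

Lemma seen_along_exists x y : e x y -> exists u, seen_along x y u.
Proof.
move=> xy; have [yv|yv] := pselect (y = v).
  have xv : x <> v by move=> xv; move: xy; rewrite xv yv eirr.
  have [u xu] := starts_geodesic_exists econn xv; exists u, x; split => //; by left.
have [u yu] := starts_geodesic_exists econn yv; exists u, y; split => //; by right.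
Qed.

Lemma seen_along_near x y u u' : e x y -> seen_along x y u -> seen_along x y u' ->
  near_nbrs e delta v u u'.
Proof.
move=> xy [z [zxy zv zu]] [z' [zxy' zv' zu']].
apply: (near_nbrs_starts esym econn hyp _ zv zv' zu zu').
by case: zxy zxy' => [->|->] [->|->]; [left|right|right; rewrite esym|left].
Qed.

Variable t : seq (V * V * V).
Let A u u' := near_nbrs e delta v u u' \/ translated_turn t u u'.
Let chain := joined_by (fun u u' => `[< A u u' >]).

Lemma chain_near u u' : near_nbrs e delta v u u' -> chain u u' 1.
Proof. by move=> uu'; apply: joined_by1; apply/asboolP; left. Qed.

(** If the middle vertex is carried to v, both ends of the turn are neighbours of v and the turn
    itself is one link, with one more link on either side. Otherwise a direction of the middle
    vertex is close to both u and u'. *)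
Lemma seen_along_turn g x y z u u' : e x y -> e y z -> (x, y, z) \in t ->
  seen_along (act g x) (act g y) u -> seen_along (act g y) (act g z) u' ->
  exists2 n, (n <= 3)%N & chain u u' n.
Proof.
move=> xy yz xyz [p [pE pv pu]] [p' [pE' pv' pu']].
have [gy|gy] := pselect (act g y = v).
  have pgx : p = act g x by case: pE => // pE; case: pv; rewrite pE.
  have pgz : p' = act g z by case: pE' => // pE'; case: pv'; rewrite pE'.
  subst p p'; exists 3 => //.
  have vx : e v (act g x) by rewrite -gy acte esym.
  have vz : e v (act g z) by rewrite -gy acte.
  apply: (@joined_by_trans _ _ _ (act g x) _ 1 2).
    apply: chain_near; apply: near_nbrs_starts pu (starts_geodesic_nbr eirr econn vx) => //.
    by left.
  apply: (@joined_by_trans _ _ _ (act g z) _ 1 1).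
    by apply: joined_by1; apply/asboolP; right; exists g, (x, y, z).
  apply: chain_near; apply: near_nbrs_starts (starts_geodesic_nbr eirr econn vz) pu' => //.
  by left.
have [w yw] := starts_geodesic_exists econn gy.
exists 2 => //; apply: (@joined_by_trans _ _ _ w _ 1 1); apply: chain_near.
  apply: near_nbrs_starts pu yw => //.
  by case: pE => ->; [right; rewrite acte|left].
apply: near_nbrs_starts yw pu' => //.
by case: pE' => ->; [left|right; rewrite acte].
Qed.

Fixpoint turns x y (p : seq V) :=
  if p is z :: p' then (x, y, z) :: turns y z p' else [::].

Lemma seen_along_path g x y p u u' : path e x (y :: p) -> {subset turns x y p <= t} ->
  seen_along (act g x) (act g y) u ->
  seen_along (act g (last x (belast y p))) (act g (last y p)) u' ->
  exists2 n, (n <= 3 * size p + 1)%N & chain u u' n.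
Proof.
elim: p x y u => [|z p IH] x y u /=.
  move=> /andP[xy _] _ xu xu'; exists 1%N => //; apply: chain_near.
  by apply: seen_along_near xu xu'; rewrite acte.
move=> /and3P[xy yz zp] tt xu xu'.
have [|w yw] := @seen_along_exists (act g y) (act g z); first by rewrite acte.
have [|n n3 nc] := @seen_along_turn g x y z u w xy yz _ xu yw.
  by apply: tt; rewrite mem_head.
have [|q qt|m m3 mc] := IH y z w _ _ yw xu'; first by rewrite /= yz.
  by apply: tt; rewrite inE qt orbT.
exists (n + m)%N; first by rewrite mulnS -addnA leq_add.
exact: joined_by_trans nc mc.
Qed.

End VertexStabiliser.

Section Undistorted.
Local Open Scope group_scope.

(** A word in S traces a path made of translates of finitely many fixed paths, ending at a translate
    of its first edge by h. The directions at v in which its edges are seen form a chain from [u0]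
    to [act h u0] of length linear in that of the word, and [cofinite_chain] reads a word in H off
    it. *)
Lemma relatively_hyperbolic_undistorted (G : groupType) (H : set G) (S : seq G) :
  relatively_hyperbolic H -> H <> setT ->
  exists F : seq G, (forall x, x \in F -> H x) /\
  exists C, forall n h, H h -> word_in S n h -> word_in F (C * n.+1) h.
Proof.
move=> [V [e [act [[esym eirr econn [delta hyp] fine] [act1 actM acte] orb stab [_ [v Hv]]]]]] HT.
(* Were v isolated, connectedness would make all of G fix v. *)
have [u0 vu0] : exists u0, e v u0.
  apply: contrapT => no; apply: HT; rewrite -Hv; apply/seteqP; split => // g _ /=.
  have [[|z p] [ep lp sp]] := gdistP econn v (act g v); first by [].
  by case: no; exists z; case/andP: ep.
have [q hq] : {q : G -> seq V & forall s, path e v (q s) /\ last v (q s) = act s v}.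
  apply: (boolp.choice (P := fun s p => path e v p /\ last v p = act s v)) => s.
  by have [p [ep lp _]] := gdistP econn v (act s v); exists p.
(* Each piece begins and ends with a translate of the edge between [u0] and v. Consecutive pieces
   share such an edge, reversed, so every turn to be considered lies inside a piece. *)
pose tt s := turns u0 v (rcons (q s) (act s u0)).
pose t := flatten [seq tt s | s <- S].
pose A u u' := near_nbrs e delta v u u' \/ translated_turn e act v t u u'.
have Acof : cofinite e act v A.
  apply: cofiniteU; last exact: cofinite_turn.
  exact: cofinite_near_nbrs.
have [F [FH hF]] := cofinite_chain act1 actM stab Acof vu0.
exists F; split; first by move=> x /FH; rewrite Hv.
pose M := (\max_(s <- S) (3 * (size (q s)).+1 + 1))%N.
exists M.+2 => n h Hh [w [sw wS hE]].
suff [k kM kc] : exists2 k, (k <= M * size w + 1)%N &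
    joined_by (fun u u' => `[< A u u' >]) u0 (act h u0) k.
  apply: word_in_mono (hF k h _ kc) => //; last by rewrite Hv.
  move: sw kM; nia.
have vhu0 : e v (act h u0).
  have hh : act h v = v by rewrite -Hv in Hh.
  by rewrite -{1}hh acte.
have nv u : e v u -> u <> v by move=> vu uv; move: vu; rewrite uv eirr.
have saw u : e v u -> starts_geodesic e v u u by apply: starts_geodesic_nbr.
have main : forall w g u u', {subset w <= S} ->
    seen_along e v (act g u0) (act g v) u ->
    seen_along e v (act (g * \prod_(x <- w) x) u0) (act (g * \prod_(x <- w) x) v) u' ->
    exists2 k, (k <= M * size w + 1)%N & joined_by (fun u u' => `[< A u u' >]) u u' k.
  elim=> [|s l IH] g u u' wS' gu gu'.
    rewrite big_nil mulg1 in gu'; exists 1%N; first by rewrite muln0.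
    apply: chain_near; apply: seen_along_near gu gu' => //.
    by rewrite acte esym.
  have sS : s \in S by apply: wS'; rewrite mem_head.
  have [|u1 gu1] := @seen_along_exists _ e eirr econn v (act (g * s) u0) (act (g * s) v).
    by rewrite acte esym.
  have [x xw|||m mM mc] := IH (g * s) u1 u'.
  - by apply: wS'; rewrite inE xw orbT.
  - exact: gu1.
  - by rewrite big_cons mulgA in gu'.
  have [eq lq] := hq s.
  have [|x xt|||k kM kc] := @seen_along_path _ _ _ act esym eirr econn delta hyp acte v t g
     u0 v (rcons (q s) (act s u0)) u u1.
  - by rewrite /= esym vu0 rcons_path eq lq acte.
  - by apply/flatten_mapP; exists s.
  - exact: gu.
  - rewrite last_rcons belast_rcons /= lq -!actM.
    by case: gu1 => z [zE zv zu]; exists z; split => //; case: zE; [right|left].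
  exists (k + m)%N; last exact: joined_by_trans kc mc.
  have : (3 * (size (q s)).+1 + 1 <= M)%N.
    by rewrite /M (big_rem s) //= leq_maxl.
  move: kM mM; rewrite size_rcons /= mulnS; lia.
apply: (main w 1) => //.
  by exists u0; rewrite !act1; split; [left|exact: nv|exact: saw].
by exists (act h u0); rewrite mul1g -hE; split; [left|exact: nv|exact: saw].
Qed.

End Undistorted.

(** * Growth of the cusped graph *)

Section CayleyGraph.
Variables (G : groupType) (S : set G).
Hypothesis Sfin : finite_set S.
Hypothesis Sgen : symmetric_generating [set: G] S.
Local Open Scope group_scope.

Let letters : seq G := fset_set S.

Lemma lettersE x : (x \in letters) = `[< S x >].
Proof. by rewrite in_fset_set //; apply/idP/asboolP; rewrite inE. Qed.

Lemma cayley_joined g g' n : joined_by (cayley S) g g' n <->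
  exists w : seq G, [/\ size w = n, {subset w <= letters} & g' = g * \prod_(x <- w) x].
Proof.
split=> [[p [ep <- <-]]|[w [<- wS ->]]].
  elim: p g ep => [|h p IH] g /=; first by exists [::]; rewrite big_nil mulg1.
  move=> /andP[/asboolP gh /IH [w [sw wS ->]]]; exists ((g^-1 * h) :: w); split.
  - by rewrite /= sw.
  - by move=> x; rewrite inE => /orP[/eqP ->|/wS //]; rewrite lettersE; apply/asboolP.
  - by rewrite big_cons !mulgA mulgV mul1g.
elim: w g wS => [|x w IH] g wS; first by rewrite big_nil mulg1; exact: joined_by0.
have [y yw|p [ep lp sp]] := IH (g * x); first by apply: wS; rewrite inE yw orbT.
exists (g * x :: p); rewrite /= sp; split => //; last by rewrite lp big_cons mulgA.
rewrite ep andbT; apply/asboolP; rewrite mulKg.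
by apply/asboolP; rewrite -lettersE; apply: wS; rewrite mem_head.
Qed.

Lemma cayley_sym : symmetric (cayley S).
Proof.
have sub g g' : cayley S g g' -> cayley S g' g.
  by move=> /asboolP/(Sgen.1); rewrite invgM invgK => ?; apply/asboolP.
by move=> g g'; apply/idP/idP; apply: sub.
Qed.

Lemma cayley_connected : graph_connected (cayley S).
Proof.
pose K := [set g : G | exists n, joined_by (cayley S) 1 g n].
have KT g : K g.
  have : [set: G] g by [].
  rewrite -Sgen.2; apply: generated_by_min => [|x Sx].
    have Jmul h g' n : joined_by (cayley S) 1 g' n -> joined_by (cayley S) h (h * g') n.
      move=> /cayley_joined[w [sw wS gw]]; apply/cayley_joined; exists w.
      by rewrite gw mul1g.
    split; first by exists 0%N; exact: joined_by0.
    move=> x y [n jx] [k /(joined_by_sym cayley_sym) jy].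
    exists (n + k)%N; apply: joined_by_trans jx _.
    move: jy => /cayley_joined[w [sw wS ew]]; apply/cayley_joined; exists w; split => //.
    by congr (_ * _); apply: (mulgI y); rewrite mulgV.
  by exists 1%N; apply: joined_by1; apply/asboolP; rewrite invg1 mul1g.
move=> g g'; have [n /cayley_joined[w [sw wS gw]]] := KT (g^-1 * g').
by exists n; apply/cayley_joined; exists w; rewrite -[\prod_(_ <- _) _]mul1g -gw mulVKg.
Qed.

Lemma word_distP g g' n :
  (word_dist S g g' <= n)%N <-> word_in letters n (g^-1 * g').
Proof.
split=> [dn|[w [sw wS gw]]].
  have /cayley_joined[w [sw wS ->]] := gdistP cayley_connected g g'.
  by exists w; rewrite sw; split => //; rewrite mulKg.
apply: leq_trans sw; apply: gdist_le; apply/cayley_joined; exists w.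
by rewrite -gw mulVKg.
Qed.

Lemma word_distgg g : word_dist S g g = 0%N.
Proof. exact: gdistxx. Qed.

Lemma word_dist_sym g g' : word_dist S g g' = word_dist S g' g.
Proof. exact: gdist_sym cayley_sym. Qed.

Lemma word_dist_triangle g g' g'' :
  (word_dist S g g'' <= word_dist S g g' + word_dist S g' g'')%N.
Proof. exact: (gdist_triangle cayley_connected). Qed.

Lemma word_dist_mul k g g' : word_dist S (k * g) (k * g') = word_dist S g g'.
Proof.
apply/eqP; rewrite eqn_leq; apply/andP; split; apply/word_distP.
  have -> : (k * g)^-1 * (k * g') = g^-1 * g' by rewrite invgM -mulgA mulKg.
  by apply/word_distP.
have -> : g^-1 * g' = (k * g)^-1 * (k * g') by rewrite invgM -mulgA mulKg.
by apply/word_distP.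
Qed.

Variable H : set G.
Hypothesis sH : subgroup H.

Lemma word_ball_poly : virtually_nilpotent H -> relatively_hyperbolic H -> H <> setT ->
  exists A, forall n, exists2 s : seq G, (size s <= n.+2 ^ A)%N &
    forall h, H h -> (word_dist S 1 h <= n)%N -> h \in s.
Proof.
move=> vn rh HT.
have [F [FH [C hC]]] := relatively_hyperbolic_undistorted letters rh HT.
have [A hA] := virtually_nilpotent_poly_growth sH vn FH.
(* The linear distortion goes into the exponent: [C * n.+1 + 2] is at most [n.+2 ^ C.+2], because
   [C.+1 < 2 ^ C.+1]. *)
exists (C.+2 * A)%N => n; have [s ss hs] := hA (C * n.+1)%N.
exists s; last first.
  by move=> h Hh /word_distP; rewrite invg1 mul1g => /(hC n h Hh); exact: hs.
apply: leq_trans ss _; rewrite expnM; case: (A) => // A'; rewrite leq_exp2r // [leqRHS]expnS.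
have : (C.+1 < 2 ^ C.+1)%N by exact: ltn_expl.
have : (2 ^ C.+1 <= n.+2 ^ C.+1)%N by rewrite leq_exp2r.
move: (2 ^ C.+1)%N (n.+2 ^ C.+1)%N => u v; nia.
Qed.

End CayleyGraph.

(** * Exponential growth of orbit balls in the cusped graph *)

Section CuspGrowth.
Variables (R : realType) (G : groupType) (H S : set G) (a : R).
Hypotheses (ha : (1 < a)%R) (sH : subgroup H).
Hypothesis Sfin : finite_set S.
Hypothesis Sgen : symmetric_generating [set: G] S.
Local Open Scope ring_scope.

Notation near := (coset_near H S).
Notation adj := (cusp_adj H S a).

Lemma coset_near_refl (r : R) g : 0 <= r -> near r g g.
Proof. by move=> r0; split; [rewrite mulVg; exact: sH.1|rewrite word_distgg]. Qed.

Lemma coset_near_trans (r r' : R) g g' g'' :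
  near r g g' -> near r' g' g'' -> near (r + r') g g''.
Proof.
move=> [h1 d1] [h2 d2]; split.
  have -> : (g^-1 * g'' = (g^-1 * g') * (g'^-1 * g''))%g by rewrite -mulgA mulVKg.
  exact: subgroup_mul.
apply: le_trans (lerD d1 d2); rewrite -natrD ler_nat.
exact: word_dist_triangle.
Qed.

Lemma coset_near_sym (r : R) g g' : near r g g' -> near r g' g.
Proof.
move=> [h d]; split; last by rewrite word_dist_sym.
by rewrite -[(g'^-1 * g)%g]invgK invgM invgK; exact: subgroup_inv.
Qed.

Lemma coset_near_le (r r' : R) g g' : r <= r' -> near r g g' -> near r' g g'.
Proof. by move=> rr [h d]; split => //; exact: le_trans d rr. Qed.

Lemma cusp_adj_sym : symmetric adj.
Proof. by move=> x y; apply/asboolP/asboolP => -[]; [right|left|right|left]. Qed.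

(** A vertical edge is governed by its upper level, so that [maxn] covers horizontal and vertical
    edges at once. *)
Lemma cusp_adjP x y : adj x y ->
  [/\ (y.2 <= x.2.+1)%N, (x.2 <= y.2.+1)%N &
    [/\ x.2 = 0%N, y.2 = 0%N & S (x.1^-1 * y.1)%g] \/
    near (a ^+ maxn x.2 y.2) x.1 y.1].
Proof.
case: x y => [g n] [g' n'] /asboolP[] [] [] /=.
- by move=> -> -> /asboolP; split => //; left.
- by move=> ->; rewrite maxnn; split => //; right.
- by move=> -> d; rewrite (maxn_idPr (leqnSn n)); split; [|exact: leqW|right].
- by move=> -> ->; rewrite cayley_sym // => /asboolP; split => //; left.
- by move=> -> /coset_near_sym d; rewrite maxnn; split => //; right.
- move=> -> /coset_near_sym d; rewrite (maxn_idPl (leqnSn n')).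
  by split; [exact: leqW|exact: leqnn|right].
Qed.

(* A path of X is followed, from its last visit to level 0, inside a single
   coset, where t steps move by at most [t * a ^+ t]. *)
Lemma cusp_joined_last x n : joined_by adj (1%g, 0%N) x n ->
  exists t g0, [/\ (t <= n)%N, (x.2 <= t)%N, joined_by adj (1%g, 0%N) (g0, 0%N) (n - t)%N &
    near (t%:R * a ^+ t) g0 x.1].
Proof.
have a0 : 0 < a by apply: lt_trans ha.
move=> [p [ep <- <-]]; elim/last_ind: p ep => [|p y IH] /=.
  by move=> _; exists 0%N, 1%g; split => //; [exact: joined_by0|apply: coset_near_refl; rewrite mul0r].
rewrite rcons_path last_rcons size_rcons => /andP[ep xy].
have [y0|y0] := eqVneq y.2 0%N.
  exists 0%N, y.1; rewrite y0 subn0; split => //; last by apply: coset_near_refl; rewrite mul0r.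
  exists (rcons p y); rewrite rcons_path ep xy last_rcons size_rcons; split => //.
  by case: (y) y0 => ? ? /= ->.
have [t [g0 [tp lt j d]]] := IH ep; have [yx _ nxy] := cusp_adjP xy.
exists t.+1, g0; rewrite subSS; split => //.
  by rewrite (leq_trans yx).
have nk : near (a ^+ t.+1) (last (1%g, 0%N) p).1 y.1.
  case: nxy => [[_ y0' _]|]; first by rewrite y0' in y0.
  apply: coset_near_le; rewrite ler_weXn2l ?(ltW ha) // geq_max (leqW lt).
  exact: leq_trans yx _.
apply: coset_near_le (coset_near_trans d nk).
by rewrite -natr1 mulrDl mul1r lerD2r ler_wpM2l // ler_weXn2l // ltW.
Qed.

(** The path is cut at its previous visit to level 0. The excursion cut off has t + 1 steps, at
    least one, which gives a recursion for orbit spheres. *)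
Lemma cusp_joined_step g n : joined_by adj (1%g, 0%N) (g, 0%N) n.+1 ->
  exists t g0, [/\ (t <= n)%N, joined_by adj (1%g, 0%N) (g0, 0%N) (n - t)%N &
    near (t.+1%:R * a ^+ t.+1) g0 g \/ S (g0^-1 * g)%g].
Proof.
have a0 : 0 < a by apply: lt_trans ha.
move=> [p [ep lp sp]]; elim/last_ind: p ep lp sp => // p y _.
rewrite rcons_path last_rcons size_rcons => /andP[ep xy] yE [sp]; subst y.
have [_ _ nxy] := cusp_adjP xy.
have jx : joined_by adj (1%g, 0%N) (last (1%g, 0%N) p) n by exists p.
have [x0|x0] := eqVneq (last (1%g, 0%N) p).2 0%N.
  exists 0%N, (last (1%g, 0%N) p).1; rewrite subn0; split => //.
    have xE : last (1%g, 0%N) p = ((last (1%g, 0%N) p).1, 0%N).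
      by rewrite [LHS]surjective_pairing x0.
    by rewrite -xE.
  case: nxy => [[_ _ sxy]|d]; [by right|left].
  by rewrite mul1r; apply: coset_near_le d; rewrite x0 expr0 expr1 ltW.
have [t [g0 [tp lt j d]]] := cusp_joined_last jx.
exists t, g0; split => //; left.
have d' : near (a ^+ t.+1) (last (1%g, 0%N) p).1 g.
  case: nxy => [[x0' _ _]|]; first by rewrite x0' in x0.
  by apply: coset_near_le; rewrite maxn0 ler_weXn2l ?(ltW ha) // leqW.
apply: coset_near_le (coset_near_trans d d').
by rewrite -natr1 mulrDl mul1r lerD2r ler_wpM2l // ler_weXn2l // ltW.
Qed.

Lemma cusp_connected0 g g' : exists n, joined_by adj (g, 0%N) (g', 0%N) n.
Proof.
have [n [p [ep <- sp]]] := cayley_connected Sfin Sgen g g'.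
exists n, [seq (h, 0%N) | h <- p]; rewrite size_map sp last_map; split => //.
elim: p g ep {sp} => //= h p IH g /andP[gh ep]; rewrite IH // andbT.
by apply/asboolP; left; apply: Or31; split.
Qed.

(** This is the recursion for orbit spheres, with at most [B ^ t.+1] ends for an excursion of t + 1
    steps; summing over compositions of n doubles the base. The added [B ^ n] makes the induction
    close. *)
Lemma geometric_convolution B n :
  (\sum_(t < n) (2 * B) ^ (n.-1 - t) * B ^ t.+1 + B ^ n <= (2 * B) ^ n)%N.
Proof.
elim: n => [|n IH]; first by rewrite big_ord0.
rewrite big_ord_recr /= subnn expn0 mul1n.
rewrite (eq_bigr (fun t : 'I_n => 2 * B * ((2 * B) ^ (n.-1 - t) * B ^ t.+1))%N); last first.
  move=> t _; rewrite mulnA -expnS; congr (_ ^ _ * _)%N.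
  by have := ltn_ord t; lia.
rewrite -big_distrr /= !(expnS _ n).
have := leq_mul (leqnn (2 * B)%N) IH.
by move: (\sum_(t < n) _)%N (B ^ n)%N ((2 * B) ^ n)%N => x y z; nia.
Qed.

Lemma cusp_sphere_growth (u : nat -> seq G) B :
  (forall t, (size (u t) <= B ^ t.+1)%N) ->
  (forall t h, H h /\ (word_dist S 1%g h)%:R <= t.+1%:R * a ^+ t.+1 \/ S h -> h \in u t) ->
  forall n, exists2 s : seq G, (size s <= (2 * B) ^ n)%N &
    forall g, joined_by adj (1%g, 0%N) (g, 0%N) n -> g \in s.
Proof.
move=> su hu n.
(* All radii up to n are treated together, since the recursion reaches back to every earlier
   sphere. *)
suff [L hL] : exists L : nat -> seq G, forall m, (m <= n)%N ->
    (size (L m) <= (2 * B) ^ m)%N /\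
    forall g, joined_by adj (1%g, 0%N) (g, 0%N) m -> g \in L m.
  by have [? ?] := hL n (leqnn _); exists (L n).
elim: n => [|n [L hL]].
  exists (fun=> [:: 1%g]) => m; rewrite leqn0 => /eqP ->; split => // g.
  by move=> [p [_ lp /size0nil pE]]; move: lp; rewrite pE => -[<-]; rewrite inE.
pose new := flatten [seq [seq (g * h)%g | g <- L (n - t)%N, h <- u t] | t <- iota 0 n.+1].
exists (fun m => if (m <= n)%N then L m else new) => m; rewrite leq_eqVlt => /orP[/eqP ->|mn].
  rewrite ltnn; split.
    rewrite size_flatten /shape -map_comp sumnE big_map -[iota _ _]/(index_iota 0 n.+1) big_mkord.
    apply: leq_trans (leq_trans (leq_addr _ _) (geometric_convolution B n.+1)).
    apply: leq_sum => t _ /=; rewrite size_allpairs leq_mul //.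
    by have [] := hL (n - t)%N (leq_subr _ _).
  move=> g /cusp_joined_step [t [g0 [tn j d]]].
  apply/flatten_mapP; exists t; first by rewrite mem_iota.
  rewrite -[g](mulVKg g0); apply: allpairs_f.
    by apply: (hL (n - t)%N (leq_subr _ _)).2.
  apply: hu; case: d => [[Hh d]|]; [left|by right]; split => //.
  rewrite -(word_dist_mul Sfin Sgen g0) mulg1 mulVKg; exact: d.
by have mn' : (m <= n)%N by []; rewrite mn'; apply: hL.
Qed.

Lemma cusp_ball_growth : virtually_nilpotent H -> relatively_hyperbolic H ->
  H <> [set: G] -> exists2 B, (0 < B)%N & forall n, exists2 s : seq G, (size s <= B ^ n)%N &
    forall g, (cusp_dist H S a (1%g, 0%N) (g, 0%N) <= n)%N -> g \in s.
Proof.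
move=> vn rh HT.
have [A hA] := word_ball_poly Sfin Sgen sH vn rh HT.
pose b := (Num.truncn a).+1.
have ab : a <= b%:R by rewrite ltW // truncnS_gt.
(* An excursion of t + 1 steps moves by at most [(2 * b) ^ t.+1], and this plus 2, the base in the
   growth of H, is at most [k ^ t.+1]. *)
pose k := (2 * b + 2)%N.
pose B0 := (k ^ A + size (fset_set S))%N.
have [u hu] : {u : nat -> seq G & forall t, (size (u t) <= B0 ^ t.+1)%N /\
    forall h, H h /\ (word_dist S 1%g h)%:R <= t.+1%:R * a ^+ t.+1 \/ S h -> h \in u t}.
  apply: (boolp.choice (P := fun t s => (size s <= B0 ^ t.+1)%N /\ forall h,
    H h /\ (word_dist S 1%g h)%:R <= t.+1%:R * a ^+ t.+1 \/ S h -> h \in s)) => t.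
  have [s ss hs] := hA ((2 * b) ^ t.+1)%N.
  exists (s ++ fset_set S); split.
    have kA : (((2 * b) ^ t.+1).+2 ^ A <= (k ^ A) ^ t.+1)%N.
      rewrite -expnM [(A * _)%N]mulnC expnM; case: (A) => // A'; rewrite leq_exp2r //.
      elim: t {s ss hs} => [|t IH]; first by rewrite !expn1 /k; lia.
      rewrite expnS [leqRHS]expnS /k -/k.
      have : (0 < (2 * b) ^ t.+1)%N by rewrite expn_gt0.
      move: IH; rewrite /k; move: ((2 * b) ^ t.+1)%N ((2 * b + 2) ^ t.+1)%N => x y; nia.
    rewrite size_cat (leq_trans (leq_add ss (leqnn _))) //.
    rewrite (leq_trans (leq_add kA (leqnn _))) // /B0.
    move: (k ^ A)%N (size _) => x y; elim: t {s ss hs kA} => [|t IH]; first by rewrite !expn1.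
    rewrite expnS [leqRHS]expnS.
    have [->|x0] := posnP x.
      by rewrite mul0n !add0n; case: (y) => // z; rewrite leq_pmulr // expn_gt0.
    have := leq_mul (leqnn (x + y)%N) IH; move: (x ^ t.+1)%N ((x + y) ^ t.+1)%N => z w; nia.
  move=> h [[Hh d]|Sh]; rewrite mem_cat; apply/orP; [left|right]; last first.
    by rewrite in_fset_set // inE.
  apply: hs => //; rewrite -(ler_nat R); apply: le_trans d _.
  rewrite natrX natrM exprMn; apply: ler_pM => //.
  - by rewrite exprn_ge0 // ltW // (lt_trans _ ha).
  - by rewrite -natrX ler_nat ltnW // ltn_expl.
  - by rewrite lerXn2r // nnegrE ?ler0n // ltW // (lt_trans _ ha).
have hS := cusp_sphere_growth (fun t => (hu t).1) (fun t => (hu t).2).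
(* A ball consists of n + 1 spheres of size at most [(2 * B0).+1 ^ n], and n + 1 is at most [2 ^ n];
   the successor keeps the base positive. *)
exists (2 * (2 * B0).+1)%N => // n.
have [L hL] : {L : nat -> seq G & forall m, (size (L m) <= (2 * B0) ^ m)%N /\
    forall g, joined_by adj (1%g, 0%N) (g, 0%N) m -> g \in L m}.
  apply: (boolp.choice (P := fun m s => (size s <= (2 * B0) ^ m)%N /\
    forall g, joined_by adj (1%g, 0%N) (g, 0%N) m -> g \in s)) => m.
  by have [s ? ?] := hS m; exists s.
exists (flatten [seq L m | m <- iota 0 n.+1]); last first.
  move=> g gn; apply/flatten_mapP; exists (cusp_dist H S a (1%g, 0%N) (g, 0%N)).
    by rewrite mem_iota.
  by apply: (hL _).2; have [m j] := cusp_connected0 1%g g; apply: gdist_joined j.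
rewrite size_flatten /shape -map_comp sumnE big_map -[iota _ _]/(index_iota 0 n.+1) big_mkord.
apply: (@leq_trans (\sum_(m < n.+1) (2 * B0).+1 ^ n)%N).
  apply: leq_sum => m _; apply: leq_trans (hL m).1 _.
  apply: (@leq_trans ((2 * B0).+1 ^ m)%N).
    by case: (nat_of_ord m) => // m'; rewrite leq_exp2r.
  by rewrite leq_pexp2l // -ltnS.
rewrite sum_nat_const card_ord.
by rewrite expnMn leq_mul // ltn_expl.
Qed.

End CuspGrowth.

(** * Carne's inequality for symmetric matrices *)

Section Chebyshev.
Variable R : realFieldType.

(** With X = cos theta, the pair is cos (k theta) and sin (k theta) / sin theta, built by the
    addition formulas. The second component is the polynomial of the second kind of index k - 1. *)
Fixpoint chebyshev (k : nat) : {poly R} * {poly R} :=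
  if k is k'.+1 then
    let: (t, u) := chebyshev k' in ('X * t - (1 - 'X^2) * u, 'X * u + t)
  else (1, 0).

Definition chebyT k := (chebyshev k).1.
Definition chebyU k := (chebyshev k).2.

Lemma chebyTS k : chebyT k.+1 = 'X * chebyT k - (1 - 'X^2) * chebyU k.
Proof. by rewrite /chebyT /chebyU /=; case: (chebyshev k). Qed.

Lemma chebyUS k : chebyU k.+1 = 'X * chebyU k + chebyT k.
Proof. by rewrite /chebyT /chebyU /=; case: (chebyshev k). Qed.

Lemma chebyTSS k : chebyT k.+2 + chebyT k = 'X * chebyT k.+1 *+ 2.
Proof. by rewrite chebyTS chebyUS chebyTS; ring. Qed.

Lemma chebyshev_pell k : 1 - chebyT k ^+ 2 = (1 - 'X^2) * chebyU k ^+ 2.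
Proof.
elim: k => [|k IH]; first by rewrite /chebyT /chebyU /=; ring.
have T2 : chebyT k ^+ 2 = 1 - (1 - 'X^2) * chebyU k ^+ 2 by rewrite -IH; ring.
by rewrite chebyTS chebyUS; ring: T2.
Qed.

Variables (N : nat) (A : 'M[R]_N.+1).
Hypothesis Asym : A^T = A.
Hypothesis Acontr : forall u : 'cV[R]_N.+1,
  \sum_i (A *m u) i 0 ^+ 2 <= \sum_i u i 0 ^+ 2.

Lemma horner_mx_sym p : (horner_mx A p)^T = horner_mx A p.
Proof.
elim/poly_ind: p => [|p c IH]; first by rewrite rmorph0 trmx0.
rewrite rmorphD rmorphM /= horner_mx_X horner_mx_C linearD /= tr_scalar_mx.
rewrite -mulmxE trmx_mul IH Asym; congr (_ + _).
have : horner_mx A ('X * p) = horner_mx A (p * 'X) by rewrite mulrC.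
by rewrite !rmorphM /= horner_mx_X.
Qed.

(** Evaluated at A, Pell's identity reads 1 - T^2 = U^2 - (A U)^2. For the symmetric matrices
    involved, diagonal entries of squares are squared norms of columns, and the right-hand side is
    nonnegative there because A contracts. *)
Lemma chebyT_mx_norm k y : \sum_i (horner_mx A (chebyT k) i y) ^+ 2 <= 1.
Proof.
set T := horner_mx A (chebyT k); set U := horner_mx A (chebyU k).
have sq (p : {poly R}) : (horner_mx A p ^+ 2) y y = \sum_i (horner_mx A p i y) ^+ 2.
  rewrite expr2 -mulmxE mxE; apply: eq_bigr => i _.
  by rewrite -{1}horner_mx_sym mxE expr2.
have AU : horner_mx A ('X * chebyU k) = A *m U by rewrite rmorphM /= horner_mx_X.
have pell : 1 - chebyT k ^+ 2 = chebyU k ^+ 2 - ('X * chebyU k) ^+ 2.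
  by rewrite chebyshev_pell; ring.
have := congr1 (fun M : 'M[R]_(N.+1) => M y y) (congr1 (horner_mx A) pell).
have subE (M M' : 'M[R]_(N.+1)) : (M - M') y y = M y y - M' y y by rewrite !mxE.
have oneE : (1 : 'M[R]_(N.+1)) y y = 1 by rewrite mxE eqxx.
rewrite !rmorphB rmorph1 !(rmorphXn (horner_mx A)) /= !subE oneE !sq => E.
rewrite -subr_ge0 E subr_ge0.
have := Acontr (col y U); under [leRHS]eq_bigr do rewrite mxE.
congr (_ <= _); apply: eq_bigr => i _; congr (_ ^+ 2); rewrite AU !mxE.
by apply: eq_bigr => j _; rewrite mxE.
Qed.

Lemma chebyT_mx_le1 k i y : `|horner_mx A (chebyT k) i y| <= 1.
Proof.
rewrite -(ler_pXn2r (n := 2)) ?nnegrE // expr1n real_normK ?num_real //.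
apply: le_trans (chebyT_mx_norm k y); rewrite (bigD1 i) //= lerDl.
by apply: sumr_ge0 => j _; exact: sqr_ge0.
Qed.

Lemma chebyT_mxS k : A *m horner_mx A (chebyT k.+1) =
  2^-1 *: (horner_mx A (chebyT k.+2) + horner_mx A (chebyT k)).
Proof.
rewrite -rmorphD chebyTSS rmorphMn rmorphM /= horner_mx_X -mulmxE.
by rewrite -scaler_nat scalerA mulVf ?scale1r // pnatr_eq0.
Qed.

Lemma chebyT_mx0 : horner_mx A (chebyT 0) = 1%:M.
Proof. by rewrite /chebyT /= rmorph1. Qed.

Lemma chebyT_mx1 : horner_mx A (chebyT 1) = A.
Proof. by rewrite /chebyT /= mulr1 mulr0 subr0 horner_mx_X. Qed.

Variables (y : 'I_N.+1) (rho : 'I_N.+1 -> nat).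
Hypothesis rho_y : rho y = 0%N.
Hypothesis Arho : forall i j, A i j != 0 -> (rho i <= (rho j).+1)%N.

Lemma mulmx_support (M : 'M[R]_N.+1) k :
  (forall j, (k < rho j)%N -> M j y = 0) ->
  forall i, (k.+1 < rho i)%N -> (A *m M) i y = 0.
Proof.
move=> M0 i ki; rewrite mxE big1 // => j _.
have [->|/Arho rij] := eqVneq (A i j) 0; first by rewrite mul0r.
by rewrite M0 ?mulr0 // -ltnS (leq_trans ki).
Qed.

Lemma chebyT_mx_support k i : (k < rho i)%N -> horner_mx A (chebyT k) i y = 0.
Proof.
suff [] : (forall i, (k < rho i)%N -> horner_mx A (chebyT k) i y = 0) /\
    (forall i, (k.+1 < rho i)%N -> horner_mx A (chebyT k.+1) i y = 0).
  by move=> H _; exact: H.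
have base j : (0 < rho j)%N -> (1%:M : 'M[R]_N.+1) j y = 0.
  by rewrite mxE; case: eqVneq => // ->; rewrite rho_y.
elim: k {i} => [|k [IH0 IH1]]; split => //.
- by rewrite chebyT_mx0.
- by rewrite chebyT_mx1 -[A]mulmx1; exact: mulmx_support base.
- move=> i ki.
  have -> : horner_mx A (chebyT k.+2) =
      2 *: (A *m horner_mx A (chebyT k.+1)) - horner_mx A (chebyT k).
    by rewrite chebyT_mxS scalerA mulfV ?scale1r ?pnatr_eq0 // addrK.
  rewrite [LHS]mxE [X in X + _]mxE [X in _ + X]mxE (mulmx_support IH1) //.
  by rewrite IH0 ?mulr0 ?subr0 // ltnW // ltnW.
Qed.

Variable z : R.
Hypothesis z1 : 1 <= z.

(* [coshz k] is the value of the k-th Chebyshev polynomial at [(z + z^-1) / 2]. *)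
Let coshz k := (z ^+ k + z^-1 ^+ k) / 2.

Lemma coshzS k : coshz 1 * coshz k.+1 = 2^-1 * (coshz k.+2 + coshz k).
Proof. by rewrite /coshz !exprS; field; rewrite gt_eqF // (lt_le_trans _ z1). Qed.

Lemma coshz_gt0 k : 0 < coshz k.
Proof.
have z0 : 0 < z by rewrite (lt_le_trans _ z1).
by rewrite divr_gt0 // addr_gt0 // exprn_gt0 // invr_gt0.
Qed.

Lemma coshz_mono k l : (k <= l)%N -> coshz k <= coshz l.
Proof.
have z0 : 0 < z by rewrite (lt_le_trans _ z1).
move=> /subnK <-; elim: (l - k)%N => // d IH; apply: le_trans IH _.
rewrite /coshz addSn ler_pM2r ?invr_gt0 //; move: (d + k)%N => m.
have e1 : 1 <= z ^+ m by rewrite exprn_ege1.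
have e2 : z^-1 ^+ m <= 1 by rewrite exprn_ile1 ?invr_ge0 ?invf_le1 // ltW.
have e0 : 0 <= z^-1 ^+ m by rewrite exprn_ge0 // invr_ge0 ltW.
have w0 : 0 <= z^-1 by rewrite invr_ge0 ltW.
have wz : z * z^-1 = 1 by rewrite mulfV // gt_eqF.
have w1 : z^-1 <= 1 by rewrite invf_le1.
rewrite !exprS.
have p1 : 0 <= (z ^+ m - 1) * (z - 1) by rewrite mulr_ge0 // subr_ge0.
have p2 : 0 <= (1 - z^-1 ^+ m) * (1 - z^-1) by rewrite mulr_ge0 // subr_ge0.
have p3 : 0 <= (z - 1) * (1 - z^-1) by rewrite mulr_ge0 // subr_ge0.
by lra.
Qed.

(** Multiplication by A averages the Chebyshev matrices of index k and k + 2, and multiplication by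
    [coshz 1] averages the values of [coshz] in the same way. Letting k vary thus replaces the
    expansion of A^n in Chebyshev polynomials. For n = 0 the support and size of T_k(A) give the
    bound. *)
Lemma carne_chebyshev n k i :
  `|(A ^+ n *m horner_mx A (chebyT k)) i y| * coshz (rho i) <= coshz 1 ^+ n * coshz k.
Proof.
elim: n k i => [|n IH] k i.
  rewrite expr0 mul1mx mul1r.
  have [ki|ki] := ltnP k (rho i).
    by rewrite chebyT_mx_support // normr0 mul0r ltW // coshz_gt0.
  rewrite -[leRHS]mul1r ler_pM ?(ltW (coshz_gt0 _)) ?chebyT_mx_le1 //.
  exact: coshz_mono.
rewrite exprSr -mulmxE -mulmxA.
case: k => [|k].
  rewrite chebyT_mx0 mulmx1 -{2}chebyT_mx1 (le_trans (IH _ _)) //.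
  have -> : coshz 0 = 1 by rewrite /coshz !expr0; field.
  by rewrite mulr1 -exprSr.
rewrite chebyT_mxS -scalemxAr mxE mulmxDr mxE normrM ger0_norm ?invr_ge0 //.
rewrite exprSr -mulrA coshzS mulrA mulrCA -!mulrA.
rewrite ler_pM2l ?invr_gt0 // mulrDr.
apply: le_trans (lerD (IH _ i) (IH _ i)); rewrite -mulrDl.
by rewrite ler_pM2r ?coshz_gt0 // ler_normD.
Qed.

Lemma carne_mx n i : `|(A ^+ n) i y| <= 2 * ((z + z^-1) / 2) ^+ n / z ^+ rho i.
Proof.
have z0 : 0 < z by rewrite (lt_le_trans _ z1).
have := carne_chebyshev n 0 i; rewrite chebyT_mx0 mulmx1.
have -> : coshz 0 = 1 by rewrite /coshz !expr0; field.
have <- : coshz 1 = (z + z^-1) / 2 by rewrite /coshz !expr1.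
rewrite mulr1 => h.
have h1 : z ^+ rho i / 2 <= coshz (rho i).
  by rewrite /coshz ler_pM2r ?invr_gt0 // lerDl exprn_ge0 // invr_ge0 ltW.
have := le_trans (ler_wpM2l (normr_ge0 _) h1) h.
rewrite ler_pdivlMr ?exprn_gt0 //.
by move: `|_| (z ^+ rho i) (coshz 1 ^+ n) => u v w; lra.
Qed.
End Chebyshev.

(** * Reversible kernels of finite range *)

Lemma esum_finite_support (R : realType) (X : choiceType) (f : X -> R) (B : {fset X}) :
  (forall x, 0 <= f x) -> (forall x, f x != 0 -> x \in B) ->
  \esum_(x in [set: X]) (f x)%:E = (\sum_(x <- B) f x)%:E.
Proof.
move=> f0 fB.
have -> : \esum_(x in [set: X]) (f x)%:E = \esum_(x in [set` B]) (f x)%:E.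
  rewrite [RHS]esum_mkcond; apply: eq_esum => x _.
  case: ifPn => // xB; have [->//|/fB xB'] := eqVneq (f x) 0.
  by rewrite mem_set in xB.
rewrite esum_fset //; last by move=> x _; rewrite lee_fin.
by rewrite fsbig_finite // set_fsetK sumEFin.
Qed.

Lemma sum_support (R : nmodType) (X : choiceType) (f : X -> R) (B C : {fset X}) :
  (forall x, f x != 0 -> x \in B) -> (forall x, f x != 0 -> x \in C) ->
  \sum_(x <- B) f x = \sum_(x <- C) f x.
Proof.
move=> fB fC.
have sub (D : {fset X}) : (forall x, f x != 0 -> x \in D) ->
    \sum_(x <- D) f x = \sum_(x <- (D `|` C)%fset) f x.
  move=> fD; apply: big_fset_incl => [|x _ xD]; first exact: fsubsetUl.
  by apply/eqP; apply: contraNT xD; exact: fD.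
rewrite (sub B fB) (sub C fC) fsetUid; symmetry; apply: big_fset_incl.
  exact: fsubsetUr.
by move=> x _ xC; apply/eqP; apply: contraNT xC; exact: fC.
Qed.

Lemma sum_fset_restrict (R : nmodType) (X : choiceType) (f : X -> R) (B C : {fset X}) :
  (B `<=` C)%fset -> \sum_(x <- B) f x = \sum_(x <- C) (if x \in B then f x else 0).
Proof.
move=> BC; rewrite -(big_fset_incl _ BC) /=; last by move=> x _ /negPf ->.
by rewrite big_seq [RHS]big_seq; apply: eq_bigr => x ->.
Qed.

Lemma sum_fsetU (R : nmodType) (X : choiceType) (f : X -> R) (B C : {fset X}) :
  (forall x, x \in B -> x \notin C) ->
  \sum_(x <- (B `|` C)%fset) f x = \sum_(x <- B) f x + \sum_(x <- C) f x.
Proof.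
move=> BC; rewrite (sum_fset_restrict f (fsubsetUl B C)).
rewrite (sum_fset_restrict f (fsubsetUr B C)) -big_split /= big_seq [RHS]big_seq.
apply: eq_bigr => x; rewrite inE; case: (boolP (x \in B)) => [/BC/negPf ->|_ /= ->].
  by rewrite addr0.
by rewrite add0r.
Qed.

Lemma sum_fset_le (R : numDomainType) (X : choiceType) (f : X -> R) (B C : {fset X}) :
  (forall x, 0 <= f x) -> (B `<=` C)%fset -> \sum_(x <- B) f x <= \sum_(x <- C) f x.
Proof.
move=> f0 BC; rewrite (sum_fset_restrict f BC).
by apply: ler_sum => x _; case: ifP.
Qed.

(* Jensen's inequality for each row of Q, summed against the reversing measure. *)
Lemma reversible_contraction (R : rcfType) N (M : 'I_N -> R) (Q : 'M[R]_N) :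
  (forall i, 0 < M i) -> (forall i j, 0 <= Q i j) -> (forall i, \sum_j Q i j <= 1) ->
  (forall i j, M i * Q i j = M j * Q j i) -> forall u : 'cV[R]_N,
  \sum_i ((\matrix_(i, j) (Num.sqrt (M i) * Q i j / Num.sqrt (M j))) *m u) i 0 ^+ 2 <=
  \sum_i u i 0 ^+ 2.
Proof.
move=> M0 Q0 Q1 rev u.
have sM i : 0 < Num.sqrt (M i) by rewrite sqrtr_gt0.
pose g i := u i 0 / Num.sqrt (M i).
have jensen i : (\sum_j Q i j * g j) ^+ 2 <= \sum_j Q i j * g j ^+ 2.
  set mu := \sum_j _ * _.
  have : 0 <= \sum_j Q i j * (g j - mu) ^+ 2.
    by apply: sumr_ge0 => j _; rewrite mulr_ge0 // sqr_ge0.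
  have -> : \sum_j Q i j * (g j - mu) ^+ 2 =
      \sum_j Q i j * g j ^+ 2 - mu * mu *+ 2 + (\sum_j Q i j) * mu ^+ 2.
    rewrite {2}/mu big_distrl big_distrl /= -sumrMnl -sumrB -big_split /=.
    by apply: eq_bigr => j _; ring.
  have := ler_wpM2r (sqr_ge0 mu) (Q1 i).
  by rewrite mul1r mulr2n -!expr2; lra.
rewrite (eq_bigr (fun i => M i * (\sum_j Q i j * g j) ^+ 2)) => [|i _]; last first.
  rewrite !mxE -[M i in RHS]sqr_sqrtr ?ltW // -exprMn big_distrr /=; congr (_ ^+ 2).
  by apply: eq_bigr => j _; rewrite mxE /g; ring.
apply: (@le_trans _ _ (\sum_i \sum_j M j * Q j i * g j ^+ 2)).
  apply: ler_sum => i _; rewrite (le_trans (ler_wpM2l (ltW (M0 i)) (jensen i))) //.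
  by rewrite big_distrr /=; apply: ler_sum => j _; rewrite mulrA rev.
rewrite exchange_big /=; apply: ler_sum => j _.
rewrite -big_distrl -big_distrr /=.
have -> : u j 0 ^+ 2 = M j * 1 * g j ^+ 2.
  rewrite /g expr_div_n sqr_sqrtr ?ltW //; field; by rewrite gt_eqF.
by rewrite ler_wpM2r ?sqr_ge0 // ler_wpM2l // ltW.
Qed.

Section FiniteRangeKernel.
Variables (R : realType) (X : choiceType) (P : X -> X -> R) (nb : X -> {fset X}).
Hypothesis P0 : forall x y, 0 <= P x y.
Hypothesis Pnb : forall x y, P x y != 0 -> y \in nb x.
Hypothesis P1 : forall x, \sum_(y <- nb x) P x y = 1.

Notation sp := (step_prob P).

Fixpoint reach (n : nat) (x : X) : {fset X} :=
  if n is n'.+1 then (\bigcup_(z <- nb x) reach n' z)%fset else [fset x]%fset.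

(** The two claims go together: turning the [esum] into a finite sum requires nonnegative terms,
    that is, the first claim at n, and the finite sum gives the first claim at n + 1. *)
Lemma step_probS_ge0 n x y : 0 <= sp n x y /\
  sp n.+1 x y = \sum_(z <- nb x) P x z * sp n z y.
Proof.
elim: n x y => [|n IH] x y.
  rewrite /= ler0n (@esum_finite_support _ _ _ (nb x)) //.
    by move=> z; rewrite mulr_ge0 // ler0n.
  by move=> z; rewrite mulf_eq0 negb_or => /andP[/Pnb].
have h0 : 0 <= sp n.+1 x y.
  by rewrite (IH x y).2; apply: sumr_ge0 => z _; rewrite mulr_ge0 // (IH z y).1.
split=> //; rewrite [LHS]/= -/(sp n.+1 _ _).
rewrite (@esum_finite_support _ _ _ (nb x)) //.
  move=> z; rewrite mulr_ge0 // -/(sp n.+1 z y) (IH z y).2.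
  by apply: sumr_ge0 => w _; rewrite mulr_ge0 // (IH w y).1.
by move=> z; rewrite mulf_eq0 negb_or => /andP[/Pnb].
Qed.

Lemma step_prob_ge0 n x y : 0 <= sp n x y.
Proof. by have [] := step_probS_ge0 n x y. Qed.

Lemma step_probS n x y : sp n.+1 x y = \sum_(z <- nb x) P x z * sp n z y.
Proof. by have [] := step_probS_ge0 n x y. Qed.

Lemma step_prob_reach n x y : sp n x y != 0 -> y \in reach n x.
Proof.
elim: n x => [|n IH] x; first by rewrite /= inE; case: (eqVneq x y); rewrite ?eqxx.
apply: contraR => yn; rewrite step_probS big1_seq // => z /andP[_ zx].
have [->|/IH yz] := eqVneq (sp n z y) 0; first by rewrite mulr0.
by case/negP: yn; apply/bigfcupP; exists z; rewrite ?zx.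
Qed.

Lemma step_prob_mass n x (B : {fset X}) : (forall y, sp n x y != 0 -> y \in B) ->
  \sum_(y <- B) sp n x y = 1.
Proof.
elim: n x B => [|n IH] x B hB.
  rewrite (@sum_support _ _ _ _ [fset x]%fset) //; last exact: (@step_prob_reach 0).
  by rewrite big_seq_fset1 /= eqxx.
rewrite (sum_support hB (@step_prob_reach n.+1 x)).
under eq_bigr do rewrite step_probS.
rewrite exchange_big /= -[RHS](P1 x) big_seq [RHS]big_seq; apply: eq_bigr => z zx.
rewrite -big_distrr /= IH ?mulr1 // => y /step_prob_reach yz.
by apply/bigfcupP; exists z; rewrite ?zx.
Qed.

Lemma step_prob_sum_le1 n x (B : {fset X}) : \sum_(y <- B) sp n x y <= 1.
Proof.
rewrite -(@step_prob_mass n x (B `|` reach n x)%fset); last first.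
  by move=> y /step_prob_reach yr; rewrite inE yr orbT.
by apply: sum_fset_le; [exact: step_prob_ge0|exact: fsubsetUl].
Qed.

Lemma step_prob_le1 n x y : sp n x y <= 1.
Proof. by have := step_prob_sum_le1 n x [fset y]%fset; rewrite big_seq_fset1. Qed.

Lemma reachSr n x y : (y \in reach n.+1 x) <-> exists2 z, z \in reach n x & y \in nb z.
Proof.
elim: n x => [|n IH] x.
  split=> [/bigfcupP[z /andP[zx _]] /=|[z]]; rewrite inE => /eqP yz.
    by exists x; rewrite ?inE // yz.
  by rewrite yz => yx; apply/bigfcupP; exists y; rewrite ?yx ?inE.
split=> [/bigfcupP[z /andP[zx _] /IH[w wz yw]]|[w /bigfcupP[z /andP[zx _] wz] yw]].
  by exists w => //; apply/bigfcupP; exists z; rewrite ?zx.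
apply/bigfcupP; exists z; first by rewrite zx.
by apply/IH; exists w.
Qed.

Lemma step_probSr n x y (B : {fset X}) : (forall z, sp n x z != 0 -> z \in B) ->
  sp n.+1 x y = \sum_(z <- B) sp n x z * P z y.
Proof.
elim: n x B => [|n IH] x B hB.
  rewrite step_probS [RHS](@sum_support _ _ _ _ [fset x]%fset); last first.
  - by move=> z; rewrite mulf_eq0 negb_or => /andP[/step_prob_reach].
  - by move=> z; rewrite mulf_eq0 negb_or => /andP[/hB].
  rewrite big_seq_fset1 /= eqxx mul1r.
  rewrite (@sum_support _ _ _ _ ([fset y] `|` nb x)%fset); last first.
  - by move=> z; rewrite mulf_eq0 negb_or inE => /andP[/Pnb ->]; rewrite orbT.
  - by move=> z; rewrite mulf_eq0 negb_or => /andP[/Pnb ->].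
  rewrite (big_fsetD1 y) /= ?inE ?eqxx // mulr1 big1_seq ?addr0 // => z.
  by rewrite !inE => /andP[_ /andP[/negPf -> _]]; rewrite mulr0.
have sub z : z \in nb x -> forall w, sp n z w != 0 -> w \in reach n.+1 x.
  by move=> zx w /step_prob_reach wz; apply/bigfcupP; exists z; rewrite ?zx.
have hB' w : sp n.+1 x w * P w y != 0 -> w \in B.
  by rewrite mulf_eq0 negb_or => /andP[/hB].
have hr w : sp n.+1 x w * P w y != 0 -> w \in reach n.+1 x.
  by rewrite mulf_eq0 negb_or => /andP[/step_prob_reach].
rewrite (sum_support hB' hr) step_probS big_seq.
under eq_bigr => z zx do rewrite (IH z _ (sub z zx)) big_distrr /=.
rewrite -big_seq exchange_big; apply: eq_bigr => w _.
by rewrite step_probS big_distrl /=; apply: eq_bigr => z _; rewrite mulrA.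
Qed.

Lemma step_prob_reversible (m : X -> R) : (forall x y, m x * P x y = m y * P y x) ->
  forall n x y, m x * sp n x y = m y * sp n y x.
Proof.
move=> rev; elim=> [|n IH] x y; first by rewrite /= eq_sym; case: eqP => [->|]; rewrite ?mulr0.
rewrite step_probS (@step_probSr n y x (reach n y `|` nb x)%fset); last first.
  by move=> z /step_prob_reach zy; rewrite inE zy.
rewrite (@sum_support _ _ _ (nb x) (reach n y `|` nb x)%fset); last first.
- by move=> z; rewrite mulf_eq0 negb_or inE => /andP[/Pnb ->]; rewrite orbT.
- by move=> z; rewrite mulf_eq0 negb_or => /andP[/Pnb ->].
rewrite !big_distrr /=; apply: eq_bigr => z _.
by rewrite mulrA rev mulrAC IH mulrAC mulrC mulrCA.
Qed.

Lemma step_prob_invariant (f g : X -> X) : cancel f g -> cancel g f ->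
  (forall x y, P (f x) (f y) = P x y) ->
  forall n x y, sp n (f x) (f y) = sp n x y.
Proof.
move=> fK gK Pf; elim=> [|n IH] x y; first by rewrite /= (inj_eq (can_inj fK)).
rewrite !step_probS.
have nbf z : P (f x) z * sp n z (f y) != 0 -> z \in (f @` (nb x))%fset.
  rewrite mulf_eq0 negb_or -{1}(gK z) Pf => /andP[/Pnb gz _].
  by apply/imfsetP; exists (g z).
have nbf' z : P (f x) z * sp n z (f y) != 0 -> z \in nb (f x).
  by rewrite mulf_eq0 negb_or => /andP[/Pnb].
rewrite (sum_support nbf' nbf) big_imfset /=; last by move=> u v _ _; exact: (can_inj fK).
by apply: eq_bigr => z _; rewrite Pf IH.
Qed.


(** * Carne's inequality for transition probabilities *)

Section Carne.
Variable m : X -> R.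
Hypothesis m0 : forall x, 0 < m x.
Hypothesis rev : forall x y, m x * P x y = m y * P y x.
Variables (y : X) (rho : X -> nat).
Hypothesis rho_y : rho y = 0%N.
Hypothesis Prho : forall u v, P u v != 0 -> (rho u <= (rho v).+1)%N.
Variable z : R.
Hypothesis z1 : 1 <= z.

(** P is restricted to a finite set B containing y and all points within n steps of x. The
    restriction is substochastic and reversible; conjugated by the square root of m it is a
    symmetric contraction, to which [carne_mx] applies. *)
Lemma carne_step_prob n x :
  sp n x y <= Num.sqrt (m y) / Num.sqrt (m x) * (2 * ((z + z^-1) / 2) ^+ n / z ^+ rho x).
Proof.
have sm v : 0 < Num.sqrt (m v) by rewrite sqrtr_gt0.
pose B := (y |` \bigcup_(k <- iota 0 n.+1) reach k x)%fset.
have rB k v : (k <= n)%N -> v \in reach k x -> v \in B.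
  move=> kn vk; rewrite !inE; apply/orP; right; apply/bigfcupP; exists k => //.
  by rewrite mem_iota andbT.
have xB : x \in B by apply: (rB 0%N) => //; rewrite inE.
(* Listing x first gives it the index [ord0] and the matrix a size of the form [N.+1]. *)
pose s := x :: (B `\ x)%fset.
have us : uniq s by rewrite /= fset_uniq andbT in_fsetD1 eqxx.
pose N := size (B `\ x)%fset.
pose e (i : 'I_N.+1) := nth x s i.
have einj : injective e.
  by move=> i j /eqP; rewrite nth_uniq // => /eqP/val_inj.
have sumE (F : X -> R) : \sum_i F (e i) = \sum_(v <- B) F v.
  rewrite (big_fsetD1 x) //= -[RHS](big_cons _ _ x _ predT) (big_nth x) big_mkord.
  by apply: eq_bigr.
have [j ej] : exists j, e j = y.
  have ys : y \in s by rewrite !inE eqxx; case: eqVneq.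
  have js : (index y s < N.+1)%N by move: ys; rewrite -index_mem.
  by exists (Ordinal js); rewrite /e nth_index.
pose Q : 'M[R]_N.+1 := \matrix_(i, k) P (e i) (e k).
pose A : 'M[R]_N.+1 :=
  \matrix_(i, k) (Num.sqrt (m (e i)) * Q i k / Num.sqrt (m (e k))).
have Asym : A^T = A.
  apply/matrixP => i k; rewrite !mxE; apply/eqP.
  rewrite eqr_div ?lt0r_neq0 //; apply/eqP.
  have sq v w : Num.sqrt (m v) * P v w * Num.sqrt (m v) = m v * P v w.
    by rewrite -[m v in RHS]sqr_sqrtr ?ltW //; ring.
  by rewrite !sq rev.
have Acontr (u : 'cV[R]_N.+1) : \sum_i (A *m u) i 0 ^+ 2 <= \sum_i u i 0 ^+ 2.
  apply: reversible_contraction => [i|i k|i|i k].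
  - exact: m0.
  - by rewrite mxE.
  - under eq_bigr do rewrite mxE.
    rewrite (sumE (P (e i))) -(P1 (e i)).
    rewrite [leRHS](@sum_support _ _ _ _ (B `|` nb (e i))%fset); last first.
    + by move=> v /Pnb vi; rewrite inE vi orbT.
    + exact: Pnb.
    by apply: sum_fset_le => //; exact: fsubsetUl.
  - by rewrite !mxE; exact: rev.
(* From a point l steps away from x, k further steps stay in B as long as k + l is at most n, so the
   truncation goes unnoticed. *)
have key k l i : (k + l <= n)%N -> e i \in reach l x ->
    (A ^+ k) i j = Num.sqrt (m (e i)) * sp k (e i) y / Num.sqrt (m y).
  elim: k l i => [|k IH] l i kl il.
    rewrite expr0 mxE /= -ej (inj_eq einj); case: eqVneq => [->|_].
      by rewrite mulr1 mulfV ?gt_eqF.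
    by rewrite mulr0 mul0r.
  rewrite exprS -mulmxE mxE step_probS.
  pose F v := Num.sqrt (m (e i)) * (P (e i) v * sp k v y) / Num.sqrt (m y).
  rewrite (eq_bigr (fun k => F (e k))) => [|i' _]; last first.
    rewrite !mxE /F; have [->|Pne] := eqVneq (P (e i) (e i')) 0.
      by rewrite mul0r !mulr0 !mul0r.
    rewrite (IH l.+1) ?addnS //; last by apply/reachSr; exists (e i) => //; exact: Pnb.
    by field; rewrite !lt0r_neq0.
  rewrite sumE -big_distrl -big_distrr /=; congr (_ * _ / _).
  apply: sum_support => v; rewrite mulf_eq0 negb_or => /andP[/Pnb vi _] //.
  apply: (rB l.+1); first by apply: leq_trans kl; rewrite addSn -addnS leq_addl.
  by apply/reachSr; exists (e i).
have e0 : e ord0 = x by [].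
have An : (A ^+ n) ord0 j = Num.sqrt (m x) * sp n x y / Num.sqrt (m y).
  by rewrite (key n 0%N) ?addn0 // e0 inE.
have -> : sp n x y = Num.sqrt (m y) / Num.sqrt (m x) * (A ^+ n) ord0 j.
  by rewrite An; field; rewrite !lt0r_neq0.
rewrite ler_pM2l ?divr_gt0 //; apply: le_trans (ler_norm _) _.
apply: (@carne_mx _ _ A Asym Acontr j (rho \o e)) => //=; first by rewrite ej.
move=> i k; rewrite !mxE => Aik; apply: Prho.
by apply: contraNneq Aik => ->; rewrite mulr0 mul0r.
Qed.
End Carne.

End FiniteRangeKernel.

(** * Concentration of the n-step distributions *)

Import numFieldNormedType.Exports.

Section Mass.
Variables (R : realType) (X : choiceType) (P : X -> X -> R) (nb : X -> {fset X}).
Hypothesis P0 : forall x y, 0 <= P x y.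
Hypothesis Pnb : forall x y, P x y != 0 -> y \in nb x.
Hypothesis P1 : forall x, \sum_(y <- nb x) P x y = 1.

Notation sp := (step_prob P).
Notation reach := (reach nb).

Definition mass n x (A : set X) : R := \sum_(y <- reach n x | y \in A) sp n x y.

Lemma massE n x A : mass n x A = \sum_(y <- reach n x) (if y \in A then sp n x y else 0).
Proof. exact: big_mkcond. Qed.

Lemma massC n x A : mass n x (~` A) = 1 - mass n x A.
Proof.
apply/eqP; rewrite eq_sym subr_eq eq_sym -(step_prob_mass P0 Pnb P1 (@step_prob_reach _ _ P nb P0 Pnb n x)).
rewrite !massE -big_split /=; apply/eqP; apply: eq_bigr => y _.
rewrite in_setC; case: (y \in A); rewrite /= ?addr0 ?add0r //.
Qed.

Lemma massI n x A B : mass n x A + mass n x B <= mass n x (A `&` B) + 1.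
Proof.
rewrite -(step_prob_mass P0 Pnb P1 (@step_prob_reach _ _ P nb P0 Pnb n x)) !massE -!big_split /=.
apply: ler_sum => y _; rewrite in_setI; have := step_prob_ge0 P0 Pnb n x y.
by case: (y \in A); case: (y \in B) => /=; lra.
Qed.

Lemma mass_gt0 n x A : 0 < mass n x A -> exists y, [/\ y \in reach n x, A y & 0 < sp n x y].
Proof.
move=> m0; apply: contrapT => no; move: m0; rewrite massE big_seq big1 ?ltxx // => y yr.
case: ifPn => // /set_mem Ay; have [//|spn] := eqVneq (sp n x y) 0.
case: no; exists y; split => //; rewrite lt0r spn.
exact: (step_prob_ge0 P0 Pnb).
Qed.

Variables (d : measure_display) (Omega : measurableType d).
Variables (Pr : X -> probability Omega R) (Y : nat -> Omega -> X).
Hypothesis chain : markov_chain P Pr Y.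

Lemma measurable_state n A : measurable (Y n @^-1` A).
Proof. exact: chain.1. Qed.

Definition cylinder n (s : nat -> X) := [set w | forall i, (i <= n)%N -> Y i w = s i].

Lemma measurable_cylinder n s : measurable (cylinder n s).
Proof.
rewrite (_ : cylinder n s = \bigcap_i (if (i <= n)%N then Y i @^-1` [set s i] else setT)).
  by apply: bigcapT_measurable => i; case: ifP => // _; exact: measurable_state.
apply/seteqP; split=> [w cw i _|w cw i ile]; first by case: ifPn => //= /cw.
by have := cw i I; rewrite ile.
Qed.

Lemma prob_split x (A B : set Omega) : measurable A -> measurable B ->
  Pr x A = (Pr x (A `&` B) + Pr x (A `&` ~` B))%E.
Proof.
move=> mA mB; rewrite -{1}(setIT A) -(setUv B) setIUr; apply: measureU.
- exact: measurableI.
- by apply: measurableI => //; exact: measurableC.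
- by rewrite setIACA setICr setI0.
Qed.

Lemma measure_fset_split x n (A : set Omega) (B : {fset X}) : measurable A ->
  Pr x (A `&` Y n @^-1` [set` B]) = (\sum_(z <- B) Pr x (A `&` Y n @^-1` [set z]))%E.
Proof.
move=> mA; elim/finSet_rect: B => B IH.
have [->|[b bB]] := fset_0Vmem B.
  rewrite big_seq_fset0 (_ : _ `&` _ = set0) ?measure0 //.
  by apply/seteqP; split => w // [_] /=; rewrite inE.
rewrite (big_fsetD1 b bB) /= -IH; last by rewrite fproperD1.
rewrite -measureU.
- congr (Pr x _); rewrite -setIUr; congr (_ `&` _); rewrite -preimage_setU; congr (_ @^-1` _).
  apply/seteqP; split => z /=.
    by have [->|zb] := eqVneq z b; [left|right; rewrite in_fsetD1 zb].
  by case=> [->//|]; rewrite in_fsetD1 => /andP[].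
- by apply: measurableI => //; exact: measurable_state.
- by apply: measurableI => //; exact: measurable_state.
- by apply/seteqP; split => w // [[_ /= ->] [_ /=]]; rewrite in_fsetD1 eqxx.
Qed.

(** The Markov property, from the cylinder formula by induction on k. The one-step extensions of the
    cylinder to [nb (s n)] already carry all its mass, so that the next state lies almost surely in
    that finite set and the recursion [step_probS] applies. *)
Lemma cylinder_step x n s k y :
  Pr x (cylinder n s `&` Y (n + k)%N @^-1` [set y]) =
  (((s 0%N == x)%:R * \prod_(i < n) P (s i) (s i.+1)) * sp k (s n) y)%:E.
Proof.
elim: k n s => [|k IH] n s.
  rewrite addn0 /=; have [<-|sy] := eqVneq (s n) y.
    rewrite mulr1 -chain.2; congr (Pr x _); apply/seteqP; split=> [w []//|w cw].
    by split => //=; exact: cw.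
  rewrite mulr0 (_ : _ `&` _ = set0) ?measure0 //.
  by apply/seteqP; split => w // [cw /= yw]; move: sy; rewrite -(cw n (leqnn n)) yw eqxx.
pose ext z i := if (i <= n)%N then s i else z.
have cylE z : cylinder n s `&` Y n.+1 @^-1` [set z] = cylinder n.+1 (ext z).
  apply/seteqP; split=> [w [cw /= yz] i|w cw].
    by rewrite /ext leq_eqVlt => /orP[/eqP ->|]; rewrite ?ltnn // ltnS => ile; rewrite ile cw.
  split=> [i ile|/=]; first by rewrite (cw i (leqW ile)) /ext ile.
  by rewrite (cw n.+1 (leqnn _)) /ext ltnn.
pose E := Y (n + k.+1)%N @^-1` [set y].
have mE : measurable E by exact: measurable_state.
pose c := (s 0%N == x)%:R * \prod_(i < n) P (s i) (s i.+1).
have prodE z : (ext z 0%N == x)%:R * \prod_(i < n.+1) P (ext z i) (ext z i.+1) = c * P (s n) z.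
  rewrite big_ord_recr /= /ext leqnn ltnn leq0n mulrA; congr (_ * _ * _).
  by apply: eq_bigr => i _; rewrite ltnW // ltn_ord.
have inside : Pr x (cylinder n s `&` Y n.+1 @^-1` [set` nb (s n)]) = Pr x (cylinder n s).
  rewrite measure_fset_split; last exact: measurable_cylinder.
  under eq_bigr => z _ do rewrite cylE [Pr x _](chain.2 x n.+1) prodE.
  by rewrite sumEFin -big_distrr /= P1 mulr1 [RHS](chain.2 x n s).
have mC := measurable_cylinder n s.
have mN : measurable (Y n.+1 @^-1` [set` nb (s n)]) by exact: measurable_state.
have outside : Pr x (cylinder n s `&` ~` (Y n.+1 @^-1` [set` nb (s n)])) = 0%E.
  have := prob_split x mC mN; rewrite inside.
  set u := Pr x (cylinder n s); have uf : u \is a fin_num by exact: fin_num_measure.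
  move: u uf (Pr x _) => [u||] // _ [v||] // [uv].
  by have -> : v = 0 by lra.
have mCE : measurable (cylinder n s `&` E) by exact: measurableI.
rewrite (prob_split x mCE mN).
rewrite [X in (_ + X)%E](_ : _ = 0%E); last first.
  apply/eqP; rewrite eq_le measure_ge0 andbT -outside le_measure ?inE //.
  - by apply: measurableI; [exact: measurableI|exact: measurableC].
  - by apply: measurableI => //; exact: measurableC.
  - by move=> w [[]].
rewrite adde0 measure_fset_split; last exact: measurableI.
rewrite (step_probS P0 Pnb) big_distrr /= -sumEFin; apply: eq_bigr => z _.
rewrite setIAC cylE /E addnS -addSn IH prodE; congr (_%:E).
by rewrite /ext ltnn mulrA.
Qed.

Lemma state_prob x n y : Pr x (Y n @^-1` [set y]) = (sp n x y)%:E.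
Proof.
have start : Pr x (cylinder 0 (fun=> x)) = 1%E.
  by rewrite [LHS](chain.2 x 0%N (fun=> x)) eqxx big_ord0 mulr1.
have := cylinder_step x 0 (fun=> x) n y; rewrite add0n eqxx big_ord0 !mul1r => <-.
have mC := measurable_cylinder 0 (fun=> x).
have mS : measurable (Y n @^-1` [set y]) by exact: measurable_state.
apply/eqP; rewrite eq_le; apply/andP; split; last first.
  by rewrite le_measure ?inE //; exact: measurableI.
rewrite (prob_split x mS mC) [X in (X + _)%E](_ : _ =
   Pr x (cylinder 0 (fun=> x) `&` Y n @^-1` [set y])); last by rewrite setIC.
rewrite [X in (_ + X <= _)%E](_ : _ = 0%E) ?adde0 //.
have c0 : Pr x (~` cylinder 0 (fun=> x)) = 0%E.
  by rewrite probability_setC // start subee.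
apply/eqP; rewrite eq_le measure_ge0 andbT -c0 le_measure ?inE //.
- by apply: measurableI => //; exact: measurableC.
- exact: measurableC.
Qed.

Lemma start_prob x : Pr x (Y 0%N @^-1` [set x]) = 1%E.
Proof. by rewrite state_prob /= eqxx. Qed.

Lemma state_prob_mass x n A : Pr x (Y n @^-1` A) = (mass n x A)%:E.
Proof.
have mS B : measurable (Y n @^-1` B) by exact: measurable_state.
have out : Pr x (Y n @^-1` ~` [set` reach n x]) = 0%E.
  have := measure_fset_split x n (reach n x) (@measurableT _ Omega).
  under eq_bigr => z _ do rewrite setTI state_prob.
  rewrite setTI sumEFin (step_prob_mass P0 Pnb P1 (@step_prob_reach _ _ P nb P0 Pnb n x)).
  by move=> E; rewrite -preimage_setC probability_setC // E subee.
have -> : Pr x (Y n @^-1` A) = Pr x (Y n @^-1` (A `&` [set` reach n x])).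
  rewrite (prob_split x (mS A) (mS [set` reach n x])).
  rewrite [X in (_ + X)%E](_ : _ = 0%E) ?adde0 //.
  apply/eqP; rewrite eq_le measure_ge0 andbT -out le_measure ?inE //.
  by apply: measurableI => //; exact: measurableC.
have := measure_fset_split x n [fset y in reach n x | y \in A]%fset (@measurableT _ Omega).
rewrite setTI (_ : [set` _] = A `&` [set` reach n x]) => [->|].
  under eq_bigr => z _ do rewrite setTI state_prob.
  by rewrite sumEFin big_fset.
apply/seteqP; split => y /=; rewrite !inE /=; first by move=> /andP[-> /set_mem].
by move=> [/mem_set -> ->].
Qed.

Lemma ae_eventually_mass x (A : nat -> set X) (eps : R) : 0 < eps ->
  {ae Pr x, forall w, exists N, forall n, (N <= n)%N -> A n (Y n w)} ->
  exists N, forall n, (N <= n)%N -> 1 - eps <= mass n x (A n).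
Proof.
move=> e0 [Z [mZ Z0 hZ]].
pose F N := \bigcap_n (if (N <= n)%N then Y n @^-1` A n else setT).
have mF N : measurable (F N).
  by apply: bigcapT_measurable => n; case: ifP => // _; exact: measurable_state.
have mUF : measurable (\bigcup_N F N) by exact: bigcupT_measurable.
have hF : {homo F : n k / (n <= k)%N >-> (n <= k)%O}.
  move=> n k nk; apply/subsetPset => w Fw i _; case: ifPn => // ki.
  by have := Fw i I; rewrite (leq_trans nk ki).
have one : Pr x (\bigcup_N F N) = 1%E.
  apply/eqP; rewrite eq_le probability_le1 //=.
  have <- : Pr x (~` Z) = 1%E by rewrite probability_setC // Z0 sube0.
  rewrite le_measure ?inE //; first exact: measurableC.
  move=> w Zw; apply: contrapT => nF; apply: Zw; apply: hZ => -[N hN]; apply: nF.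
  by exists N => // n _; case: ifPn => // Nn; exact: hN.
have cv : (Pr x \o F) n @[n --> \oo] --> 1%E.
  by rewrite -one; exact: nondecreasing_cvg_mu.
have [N _ hN] : \forall n \near \oo, ((1 - eps)%:E < (Pr x \o F) n)%E.
  have op : nbhs (1%E : \bar R) [set y | ((1 - eps)%:E < y)%E].
    apply: open_nbhs_nbhs; split; first exact: open_ereal_gt_ereal.
    by rewrite /= lte_fin ltrBlDr ltrDl.
  exact: cv op.
exists N => n Nn; rewrite -lee_fin -state_prob_mass.
apply: (le_trans (ltW (hN N (leqnn N)))).
rewrite le_measure ?inE //; first exact: measurable_state.
by move=> w /(_ n I); rewrite Nn.
Qed.

Lemma ae_mixture (m : X -> R) x (Q : set Omega) : (forall z, 0 < m z) ->
  {ae mixture m Pr, forall w, Q w} -> {ae Pr x, forall w, Q w}.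
Proof.
move=> m0 [Z [mZ Z0 hZ]]; exists Z; split => //.
have : (((m x)%:E * Pr x Z) <= 0)%E.
  rewrite -Z0; apply: (@le_trans _ _ (\esum_(y in [set x]) ((m y)%:E * Pr y Z))%E).
    by rewrite esum_set1 // mule_ge0 // lee_fin ltW.
  rewrite /mixture esum_mkcond; apply: le_esum => y _; case: ifP => // _.
  by rewrite mule_ge0 // lee_fin ltW.
rewrite pmule_rle0 ?lte_fin // => le0; apply/eqP.
by rewrite eq_le le0 measure_ge0.
Qed.

Lemma ae_start x : {ae Pr x, forall w, Y 0%N w = x}.
Proof.
exists (~` (Y 0%N @^-1` [set x])); split => //.
  by apply: measurableC; exact: measurable_state.
by rewrite probability_setC ?start_prob ?subee //; exact: measurable_state.
Qed.

(** Replacing [Y 0] by x and almost sure convergence by convergence in probability removes the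
    probability space from the argument. *)
Lemma ae_cvg_mass (m : X -> R) x (f : nat -> X -> X -> R) (l eps delta : R) :
  (forall z, 0 < m z) -> 0 < eps -> 0 < delta ->
  {ae mixture m Pr, forall w, (fun n => f n (Y 0%N w) (Y n w)) @ \oo --> l} ->
  exists N, forall n, (N <= n)%N ->
    1 - delta <= mass n x [set y | `|f n x y - l| < eps].
Proof.
move=> m0 e0 d0 /(@ae_mixture _ x _ m0) hae.
apply: ae_eventually_mass => //.
have := negligibleU hae (ae_start x); apply: negligibleS => w nw.
rewrite -setCI => -[cw xw]; apply: nw.
move/cvgrPdist_lt : cw => /(_ _ e0)[N _ hN].
by exists N => n Nn /=; rewrite distrC -xw; exact: hN.
Qed.

End Mass.

(** * The walk on the cusped graph *)

Lemma word_in_finite (G : groupType) (F : seq G) n : finite_set [set g | word_in F n g].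
Proof.
suff [s hs] : exists s : seq G, forall g, word_in F n g -> g \in s.
  by apply: (@sub_finite_set _ _ [set` s]) => [g /hs|]; [|exact: finite_seq].
elim: n => [|n [s hs]].
  by exists [:: 1%g] => g [w [sw _ ->]]; case: w sw => // _; rewrite big_nil inE.
exists (1%g :: [seq (x * g)%g | x <- F, g <- s]) => g [[|x w] [sw wF ->]].
  by rewrite big_nil inE eqxx.
rewrite big_cons inE; apply/orP; right; apply: allpairs_f.
  by apply: wF; rewrite mem_head.
by apply: hs; exists w; split => // y yw; apply: wF; rewrite inE yw orbT.
Qed.

Lemma sum_fset_le_esum (R : realType) (X : choiceType) (f : X -> R) (B : {fset X}) :
  (forall x, 0 <= f x) ->
  ((\sum_(x <- B) f x)%:E <= \esum_(x in [set: X]) (f x)%:E)%E.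
Proof.
move=> f0; pose g x := if x \in B then f x else 0.
have -> : \sum_(x <- B) f x = \sum_(x <- B) g x.
  by rewrite big_seq [RHS]big_seq; apply: eq_bigr => x xB; rewrite /g xB.
rewrite -(@esum_finite_support _ _ g B).
- by apply: le_esum => x _; rewrite lee_fin /g; case: ifP.
- by move=> x; rewrite /g; case: ifP.
- by move=> x; rewrite /g; case: ifP => //; rewrite eqxx.
Qed.

Section CuspedWalk.
Variables (R : realType) (G : groupType) (H S : set G) (a : R).
Variables (m0 pp : R) (p q c : nat -> R) (P : G * nat -> G * nat -> R).
Hypothesis hG : cusped_pair H S.
Hypothesis ha : 1 < a.
Hypothesis hpar : walk_parameters H S a m0 pp p q c.
Hypothesis hP : walk_transitions H S a m0 pp p q c P.

Notation m := (walk_measure H S a m0 c).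
Notation adj := (cusp_adj H S a).
Notation near := (coset_near H S).
Notation rho := (cusp_dist H S a).
Notation gH := (growth H S).
Notation o := (1%g : G, 0%N).

Lemma peripheral_subgroup : subgroup H.
Proof. by case: hG => -[]. Qed.
Let sH := peripheral_subgroup.

Lemma peripheral_proper : H <> [set: G].
Proof. by case: hG => _ _ []. Qed.

Lemma generators_finite : finite_set S.
Proof. by case: hG => _ _ _ []. Qed.
Let Sfin := generators_finite.

Lemma generators_symmetric : symmetric_generating [set: G] S.
Proof. by case: hG => _ _ _ []. Qed.
Let Sgen := generators_symmetric.

Let a0 : 0 < a. Proof. exact: lt_trans ha. Qed.

Lemma generators_nonempty : S !=set0.
Proof.
apply/set0P/negP => /eqP S0; apply: peripheral_proper.
have T1 : [set: G] `<=` [set 1%g].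
  rewrite -Sgen.2 S0; apply: generated_by_min => //; split=> // x y -> ->.
  by rewrite /= invg1 mulg1.
apply/seteqP; split => // g _; rewrite (T1 g I); exact: sH.1.
Qed.

Lemma word_ball_finite g (r : R) : finite_set [set g' | (word_dist S g g')%:R <= r].
Proof.
apply: (@sub_finite_set _ _ ((fun h => g * h)%g @`
    [set h | word_in (fset_set S) (Num.truncn r) h])); last first.
  by apply: finite_image; exact: word_in_finite.
move=> g' /= dr; exists (g^-1 * g')%g; last by rewrite mulVKg.
apply/(word_distP Sfin Sgen).
have r0 : 0 <= r by rewrite (le_trans _ dr).
by rewrite truncn_ge_nat.
Qed.

Lemma growth_fin (r : R) : finite_set [set h | H h /\ (word_dist S 1%g h)%:R <= r].
Proof. by apply: sub_finite_set (word_ball_finite 1%g r) => h []. Qed.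

Lemma growth_gt0 (r : R) : 0 <= r -> 0 < gH r.
Proof.
move=> r0; rewrite ltr0n cardfs_gt0; apply/fset0Pn; exists 1%g.
rewrite in_fset_set ?inE /=; last exact: growth_fin.
by split; [exact: sH.1|rewrite word_distgg].
Qed.

Lemma growth_exp_gt0 n : 0 < gH (a ^+ n).
Proof. by apply: growth_gt0; rewrite exprn_ge0 // ltW. Qed.

Lemma measure_gt0 x : 0 < m x.
Proof.
have [[m00 _ _ _ c0] _ _ _] := hpar; rewrite /walk_measure.
by case: (x.2) => // n; rewrite divr_gt0 ?c0 // growth_exp_gt0.
Qed.

Lemma cusp_adj_finite x : finite_set [set y | adj x y].
Proof.
pose W := [set g' | (word_dist S x.1 g')%:R <= a ^+ x.2.+1].
apply: (@sub_finite_set _ _ (W `*` `I_(x.2.+2))); last first.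
  by apply: finite_setX; [exact: word_ball_finite|exact: finite_II].
move=> y xy; have [yx _ d] := cusp_adjP sH Sgen xy.
split => //=; case: d => [[x0 _ Sxy]|[_ d]].
  apply: (@le_trans _ _ 1); last by rewrite exprn_ege1 // ltW.
  rewrite -[leRHS]/(1%:R) ler_nat; apply/(word_distP Sfin Sgen)/word_in_letter.
  by rewrite in_fset_set // inE.
apply: le_trans d _; rewrite ler_weXn2l ?(ltW ha) // geq_max leqnSn //.
Qed.

Definition nbs x := fset_set [set y | adj x y].

Lemma mem_nbs x y : (y \in nbs x) = adj x y.
Proof. by rewrite in_fset_set; [apply/idP/idP; rewrite inE|exact: cusp_adj_finite]. Qed.

Lemma transition_ge0 x y : 0 <= P x y.
Proof. by case: hP => -[]. Qed.

(** The Cayley neighbours receive [pp^-1] in total, and the neighbours on level 1 the complement, by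
    the first parameter equation; a further point would push the sum above 1. *)
Lemma level0_support g y : P (g, 0%N) y != 0 -> adj (g, 0%N) y.
Proof.
case: hP => -[P0 P1] hP0 hPv _ _ Py.
have [_ [hpp _ _ _] _ _] := hpar.
pose E1 := ((fun h => ((g * h)%g, 0%N)) @` fset_set [set h | cayley S 1%g h])%fset.
pose E2 := ((fun h => ((g * h)%g, 1%N)) @` fset_set [set h | H h /\ (word_dist S 1%g h)%:R <= a])%fset.
have cE : [set h | cayley S 1%g h] = S.
  by apply/seteqP; split => h /=; rewrite /cayley /= invg1 mul1g => /asboolP.
have cfin : finite_set [set h | cayley S 1%g h] by rewrite cE.
have E1P z : z \in E1 -> z.2 = 0%N /\ cayley S g z.1.
  move=> /imfsetP[h /=]; rewrite in_fset_set // inE cE /= => Sh ->; split => //.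
  by apply/asboolP; rewrite mulKg.
have nE h : H h /\ (word_dist S 1%g h)%:R <= a -> near (a ^+ 1) g (g * h)%g.
  move=> [Hh d]; split; first by rewrite mulKg.
  by rewrite -{1}[g]mulg1 word_dist_mul // expr1.
have E2P z : z \in E2 -> z.2 = 1%N /\ near (a ^+ 1) g z.1.
  by move=> /imfsetP[h /=]; rewrite in_fset_set ?inE; [move=> /nE ? ->|exact: growth_fin].
have s1 : \sum_(z <- E1) P (g, 0%N) z = pp^-1.
  rewrite big_seq (eq_bigr (fun=> (pp * (cayley_degree S)%:R)^-1)); last first.
    by case=> g' k /E1P /= [-> gz]; exact: hP0.
  rewrite -big_seq big_const_seq count_predT iter_addr_0.
  have -> : size E1 = cayley_degree S.
    by rewrite [LHS]card_imfset //= => h h' [/mulgI].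
  rewrite -[(_)^-1 *+ _]mulr_natl invfM mulrCA mulfV ?mulr1 // pnatr_eq0 -lt0n cardfs_gt0.
  have [s Ss] := generators_nonempty; apply/fset0Pn; exists s.
  by rewrite in_fset_set // inE cE.
have s2 : \sum_(z <- E2) P (g, 0%N) z = gH a / (p 0%N * gH (a ^+ 2)).
  rewrite big_seq (eq_bigr (fun=> (p 0%N * gH (a ^+ 2))^-1)); last first.
    by case=> g' k /E2P /= [-> gz]; have [_] := hPv 0%N g g' gz.
  rewrite -big_seq big_const_seq count_predT iter_addr_0 mulr_natl; congr (_ *+ _).
  by rewrite [LHS]card_imfset //= => h h' [/mulgI].
have [yE|yE] := boolP (y \in (E1 `|` E2)%fset).
  move: yE; rewrite inE => /orP[/E1P|/E2P] [y2 yn]; apply/asboolP; left.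
    by apply: Or31; split.
  by apply: Or33; rewrite y2.
have disj z : z \in E1 -> z \notin E2.
  by move=> /E1P[z0 _]; apply/negP => /E2P[]; rewrite z0.
have := sum_fset_le_esum (y |` (E1 `|` E2))%fset (P0 (g, 0%N)).
rewrite P1 lee_fin big_fsetU1 //= sum_fsetU // s1 s2 hpp gerDr => le0.
by case/negP: Py; rewrite eq_le le0 P0.
Qed.

Lemma transition_adj x y : P x y != 0 -> adj x y.
Proof.
case: x => g [|n]; first exact: level0_support.
by case: hP => _ _ _ hadj _; exact: hadj.
Qed.

Lemma transition_nbs x y : P x y != 0 -> y \in nbs x.
Proof. by move=> /transition_adj; rewrite mem_nbs. Qed.

Lemma transition_sum x : \sum_(y <- nbs x) P x y = 1.
Proof.
case: hP => -[P0 P1] _ _ _ _; have := P1 x.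
by rewrite (esum_finite_support (P0 x) (@transition_nbs x)) => -[].
Qed.

Lemma transition_reversible x y : m x * P x y = m y * P y x.
Proof. by case: hP => _ _ _ _ []. Qed.

Lemma transition_invariant k x y : P (cusp_act k x) (cusp_act k y) = P x y.
Proof. by case: hP => _ _ _ _ []. Qed.

Lemma cusp_joined_down g n : joined_by adj (g, n) (g, 0%N) n.
Proof.
elim: n => [|n IH]; first exact: joined_by0.
apply: (@joined_by_trans _ _ _ (g, n) _ 1 n) => //; apply: joined_by1.
rewrite cusp_adj_sym; apply/asboolP; left; apply: Or33; split => //=.
by apply: coset_near_refl => //; rewrite exprn_ge0 // ltW.
Qed.

Lemma cusp_connected : graph_connected adj.
Proof.
move=> [g n] [g' n']; have [k j] := cusp_connected0 H a Sfin Sgen g g'.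
exists (n + (k + n'))%N; apply: joined_by_trans (cusp_joined_down _ _) _.
apply: joined_by_trans j _; apply: joined_by_sym; first exact: cusp_adj_sym.
exact: cusp_joined_down.
Qed.

(** * Distribution of the level of the walk *)

Notation sp := (step_prob P).
Let P0 := transition_ge0.
Let Pnb := transition_nbs.
Let P1 := transition_sum.

Lemma step_prob_cusp_invariant n k x y : sp n (cusp_act k x) (cusp_act k y) = sp n x y.
Proof.
apply: (@step_prob_invariant _ _ P nbs P0 Pnb (cusp_act k) (cusp_act k^-1%g)).
- by move=> [g i]; rewrite /cusp_act /= mulKg.
- by move=> [g i]; rewrite /cusp_act /= mulVKg.
- exact: transition_invariant.
Qed.

Notation mass := (mass P nbs).

(** Reversibility exchanges o and (g, k) at the cost of the factor [m (1, k) / m0], and translation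
    by the inverse of g yields a path from (1, k) to (g^-1, 0). These end points are distinct for
    distinct g, so their probabilities sum to at most 1. *)
Lemma level_mass n k : mass n o [set y | y.2 = k] <= m (1%g, k) / m0.
Proof.
pose D := [fset y in reach nbs n o | y \in [set y : G * nat | y.2 = k]]%fset.
have DP y : y \in D -> y.2 = k by rewrite !inE /= => /andP[_ /set_mem].
have -> : mass n o [set y | y.2 = k] = \sum_(y <- D) sp n o y by rewrite big_fset.
have mm0 : 0 < m0 by exact: measure_gt0 o.
pose f (y : G * nat) : G * nat := (y.1^-1%g, 0%N).
rewrite (eq_big_seq (fun y => m (1%g, k) / m0 * sp n (1%g, k) (f y))); last first.
  case=> g i /DP /= ->.
  have := step_prob_reversible P0 Pnb transition_reversible n o (g, k).
  rewrite -(step_prob_cusp_invariant n g^-1%g (g, k)) /cusp_act /= mulVg mulg1.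
  rewrite -[m o]/m0 => E; apply: (mulfI (lt0r_neq0 mm0)); rewrite E mulrA.
  by rewrite mulrCA mulfV ?mulr1 // lt0r_neq0.
rewrite -big_distrr /= -[leRHS]mulr1 ler_wpM2l ?divr_ge0 ?(ltW mm0) ?(ltW (measure_gt0 _)) //.
have finj : {in D &, injective f}.
  by move=> [g i] [g' i'] /DP /= -> /DP /= -> [/invg_inj ->].
have /= <- := big_imfset +%R imfset_key (fun z => sp n (1%g, k) z) finj.
exact: (step_prob_sum_le1 P0 Pnb P1).
Qed.

Lemma level_measure_decay : exists C beta : R, [/\ 0 < C, 0 < beta < 1 &
  forall k, m (1%g, k.+1) <= C * beta ^+ k].
Proof.
have [[m00 _ _ q0 c0] _ [alpha al1 hal] [beta b01 hb]] := hpar.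
(* The condition on beta bounds consecutive ratios of m / q rather than of m. *)
pose w k := m (1%g, k.+1) / q k.
have w0 k : 0 < w k by rewrite divr_gt0 // measure_gt0.
have wS k : w k.+1 <= beta * w k.
  rewrite -ler_pdivrMr //; apply: le_trans (ltW (hb k.+1 isT)).
  rewrite le_eqVlt; apply/orP; left; apply/eqP; rewrite /w /walk_measure /=.
  have gk := growth_exp_gt0 k.+1; have gk' := growth_exp_gt0 k.+2.
  have ck := c0 k.+1 isT; have ck' := c0 k.+2 isT; have qk := q0 k; have qk' := q0 k.+1.
  by field; rewrite !lt0r_neq0.
have wk k : w k <= w 0%N * beta ^+ k.
  elim: k => [|k IH]; first by rewrite expr0 mulr1.
  apply: le_trans (wS k) _; rewrite exprS [leRHS]mulrCA ler_pM2l //; by case/andP: b01.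
(* The bound by alpha starts at index 1, hence the extra term. *)
have qk k : q k <= alpha + q 0%N.
  case: k => [|k]; first by rewrite lerDr (le_trans _ al1).
  have [_ _ /andP[_ qa]] := hal k.+1 isT; apply: le_trans qa _.
  by rewrite lerDl ltW.
exists (w 0%N * (alpha + q 0%N)), beta; split => //.
  by rewrite mulr_gt0 // addr_gt0 // (lt_le_trans _ al1).
move=> k; have -> : m (1%g, k.+1) = w k * q k by rewrite /w divfK // lt0r_neq0.
by rewrite [leRHS]mulrAC; apply: ler_pM => //; rewrite ltW.
Qed.

Lemma geometric_tail (x : R) K n : 0 < x < 1 ->
  \sum_(i < n) x ^+ (K + i) <= x ^+ K / (1 - x).
Proof.
move=> /andP[x0 x1]; rewrite ler_pdivlMr ?subr_gt0 //.
have -> : (\sum_(i < n) x ^+ (K + i)) * (1 - x) = x ^+ K - x ^+ (K + n).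
  elim: n => [|n IH]; first by rewrite big_ord0 mul0r addn0 subrr.
  by rewrite big_ord_recr /= mulrDl IH addnS exprS; ring.
by rewrite gerBl exprn_ge0 // ltW.
Qed.

Lemma mass_low_level (eps : R) : 0 < eps -> exists K, forall n,
  1 - eps <= mass n o [set y | (y.2 <= K)%N].
Proof.
move=> e0; have [C [beta [C0 b01 hC]]] := level_measure_decay.
have /andP[b0 b1] := b01.
have mm0 : 0 < m0 by exact: measure_gt0 o.
have [K hK] : exists K, C / m0 * (beta ^+ K / (1 - beta)) <= eps.
  have := @cvg_expr R beta; rewrite ger0_norm ?ltW // => /(_ b1).
  move=> /cvgrPdist_lt/(_ (eps / (C / m0) * (1 - beta))) [].
    by rewrite mulr_gt0 ?subr_gt0 // !divr_gt0.
  move=> K _ /(_ K (leqnn K)) /=; rewrite sub0r normrN ger0_norm ?exprn_ge0 ?ltW //.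
  move=> h; exists K; rewrite mulrC -ler_pdivlMr ?divr_gt0 //.
  by rewrite ler_pdivrMr ?subr_gt0 // ltW.
exists K => n.
have -> : [set y : G * nat | (y.2 <= K)%N] = ~` [set y | (K < y.2)%N].
  apply/seteqP; split => y /=; first by rewrite leqNgt => /negP.
  by move=> /negP; rewrite -leqNgt.
rewrite (massC P0 Pnb P1) lerB //; apply: le_trans hK.
pose L := (\max_(y <- reach nbs n o) y.2).+1.
apply: (@le_trans _ _ (\sum_(i < L) mass n o [set y | y.2 = (K.+1 + i)%N])).
  rewrite massE; under [leRHS]eq_bigr do rewrite massE.
  rewrite exchange_big /= big_seq [leRHS]big_seq; apply: ler_sum => y yr.
  case: ifPn => [/set_mem /= Ky|_]; last first.
    by apply: sumr_ge0 => i _; case: ifP => // _; exact: (step_prob_ge0 P0 Pnb).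
  have yL : (y.2 - K.+1 < L)%N.
    rewrite /L ltnS (leq_trans (leq_subr _ _)) //.
    by rewrite (big_rem y) //= leq_maxl.
  rewrite (bigD1 (Ordinal yL)) //= mem_set /= ?subnKC // lerDl.
  by apply: sumr_ge0 => i _; case: ifP => // _; exact: (step_prob_ge0 P0 Pnb).
apply: (@le_trans _ _ (\sum_(i < L) C / m0 * beta ^+ (K + i))).
  apply: ler_sum => i _; apply: le_trans (level_mass _ _) _.
  by rewrite [leRHS]mulrAC ler_pM2r ?invr_gt0 // addSn hC.
by rewrite -big_distrr /= ler_pM2l ?divr_gt0 // geometric_tail.
Qed.

(** * Orbit balls and the critical exponent *)

Definition orbit_ball n := fset_set [set g : G | (rho o (g, 0%N) <= n)%N].

Lemma cusp_growth : exists2 B, (0 < B)%N & forall n, exists2 s : seq G, (size s <= B ^ n)%N &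
    forall g, (rho o (g, 0%N) <= n)%N -> g \in s.
Proof.
by apply: cusp_ball_growth => //; [case: hG => -[]|case: hG|exact: peripheral_proper].
Qed.

Lemma mem_orbit_ball n g : (g \in orbit_ball n) = (rho o (g, 0%N) <= n)%N.
Proof.
have [B _ hB] := cusp_growth; have [s _ hs] := hB n.
rewrite in_fset_set; first by apply/idP/idP; rewrite inE.
by apply: (@sub_finite_set _ _ [set` s]) => [g' /hs|]; [|exact: finite_seq].
Qed.

Lemma orbit_ball_ge1 n : (1 <= #|` orbit_ball n|)%N.
Proof.
rewrite cardfs_gt0; apply/fset0Pn; exists 1%g.
by rewrite mem_orbit_ball /cusp_dist gdistxx.
Qed.

Lemma critical_exponent_finite : exists D : R, [/\ 0 <= D,
  critical_exponent H S a = D%:E &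
  forall eps, 0 < eps -> exists N, forall n, (N <= n)%N ->
    (#|` orbit_ball n|)%:R <= expR ((D + eps) * n%:R)].
Proof.
pose u n : \bar R := (ln (#|` orbit_ball n|)%:R / n%:R)%:E.
have uE : critical_exponent H S a = limn_esup u by [].
have u0 n : (0 <= u n)%E.
  by rewrite lee_fin divr_ge0 // ln_ge0 // (ler_nat R 1); exact: orbit_ball_ge1.
have [B B0 hB] := cusp_growth.
have uB n : (u n <= (ln (B%:R : R))%:E)%E.
  rewrite lee_fin; case: n => [|n].
    by rewrite invr0 mulr0 ln_ge0 // (ler_nat R 1).
  have [s ss hs] := hB n.+1.
  rewrite ler_pdivrMr ?ltr0n // mulr_natr -lnXn ?ltr0n // ler_ln ?posrE ?ltr0n //; last first.
  - by rewrite -natrX ltr0n expn_gt0 B0.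
  - exact: orbit_ball_ge1.
  rewrite -natrX ler_nat (leq_trans _ ss) // uniq_leq_size ?fset_uniq // => g.
  by rewrite mem_orbit_ball => /hs.
have L0 : (0 <= limn_esup u)%E.
  apply: le_ereal_inf_tmp => _ [V [k _ hV] <-].
  apply: (@le_trans _ _ (u k)) => //; apply: ereal_sup_ubound.
  by exists k => //; apply: hV => /=.
have LB : (limn_esup u <= (ln (B%:R : R))%:E)%E.
  apply: (@le_trans _ _ (ereal_sup [set u x | x in setT])).
    by apply: ereal_inf_lbound; exists setT => //; exact: filterT.
  by apply: ge_ereal_sup => _ [n _ <-].
have Lfin : limn_esup u \is a fin_num.
  by rewrite ge0_fin_numE // (le_lt_trans LB) // ltry.
exists (fine (limn_esup u)); rewrite uE fineK //; split => //; first exact: fine_ge0.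
move=> eps e0.
have : (limn_esup u < (fine (limn_esup u) + eps)%:E)%E.
  by rewrite -{1}(fineK Lfin) lte_fin ltrDl.
move=> /ereal_inf_lt[_ [V [N _ hV] <-] hsup]; exists N.+1 => -[//|n] Nn.
have : (u n.+1 < (fine (limn_esup u) + eps)%:E)%E.
  apply: le_lt_trans hsup; apply: ereal_sup_ubound; exists n.+1 => //.
  by apply: hV; exact: ltnW.
rewrite lte_fin ltr_pdivrMr ?ltr0n // => /ltW h.
rewrite -[leLHS]lnK ?posrE ?ltr0n; last exact: orbit_ball_ge1.
by rewrite ler_expR.
Qed.

(** Only the kernel and the graph enter here, which allows the constant of the theorem to be chosen
    before a chain is given. *)
Definition drift_in_mass l := forall eps delta : R, 0 < eps -> 0 < delta ->
  exists N, forall n, (N <= n)%N ->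
    1 - delta <= mass n o [set y | `|(rho o y)%:R / n%:R - l| < eps].

Definition entropy_in_mass h := forall eps delta : R, 0 < eps -> 0 < delta ->
  exists N, forall n, (N <= n)%N ->
    1 - delta <= mass n o [set y | `|- (n%:R^-1 * ln (sp n o y)) - h| < eps].

(** The two sets overlap in mass at least 1/2. Positivity of [sp] at the common point matters when
    its logarithm is inverted. *)
Lemma mass_meet n (A B : set (G * nat)) :
  1 - 4^-1 <= mass n o A -> 1 - 4^-1 <= mass n o B ->
  exists y, [/\ A y, B y & 0 < sp n o y].
Proof.
move=> hA hB; have := massI P0 Pnb P1 n o A B => hI.
have [|y [_ [Ay By] spy]] := mass_gt0 P0 Pnb (n := n) (x := o) (A := A `&` B); first by lra.
by exists y.
Qed.

Lemma drift_unique l l' : drift_in_mass l -> drift_in_mass l' -> l = l'.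
Proof.
move=> hl hl'; apply/eqP/contraT => ll'.
have e0 : 0 < `|l - l'| / 2 by rewrite divr_gt0 // normr_gt0 subr_eq0.
have d0 : 0 < 4^-1 :> R by [].
have [N hN] := hl _ _ e0 d0; have [N' hN'] := hl' _ _ e0 d0.
have [y [/= h h' _]] := mass_meet (hN _ (leq_maxl N N')) (hN' _ (leq_maxr N N')).
move: h h'; set t := _ / _ => h h'.
have : `|l - l'| <= `|t - l| + `|t - l'|.
  by rewrite -[X in _ <= X + _]normrN opprB; apply: le_trans (ler_normD _ _); rewrite addrA subrK.
by move: h h'; lra.
Qed.

Lemma drift_ge0 l : drift_in_mass l -> 0 <= l.
Proof.
move=> hl; apply/ler_addgt0Pr => e e0.
have [N hN] := hl e 4^-1 e0 (ltac:(by [])).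
have [y [/= h _ _]] := mass_meet (hN N (leqnn N)) (hN N (leqnn N)).
have : 0 <= (rho o y)%:R / N%:R :> R by rewrite divr_ge0.
by move: h; rewrite ltr_norml => /andP[]; lra.
Qed.

Lemma entropy_ge0 h : entropy_in_mass h -> 0 <= h.
Proof.
move=> hh; apply/ler_addgt0Pr => e e0.
have [N hN] := hh e 4^-1 e0 (ltac:(by [])).
have [y [/= he _ _]] := mass_meet (hN N (leqnn N)) (hN N (leqnn N)).
have : 0 <= - (N%:R^-1 * ln (sp N o y)).
  rewrite -mulrN mulr_ge0 ?invr_ge0 // oppr_ge0 ln_le0 //.
  exact: (step_prob_le1 P0 Pnb P1).
by move: he; rewrite ltr_norml => /andP[]; lra.
Qed.

Lemma exp_unbounded (x C : R) : 0 < x -> exists N, forall n, (N <= n)%N -> C < expR (x * n%:R).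
Proof.
move=> x0; exists (Num.truncn (C / x)).+1 => n Nn.
apply: (@lt_le_trans _ _ (1 + x * n%:R)); last exact: expR_ge1Dx.
have : C / x < n%:R by rewrite (lt_le_trans (truncnS_gt _)) // ler_nat.
by rewrite ltr_pdivrMr // mulrC; lra.
Qed.

Lemma entropy_le_growth l h : drift_in_mass l -> entropy_in_mass h ->
  (h%:E <= l%:E * critical_exponent H S a)%E.
Proof.
move=> hl hh; have [D [D0 -> hD]] := critical_exponent_finite.
have l0 := drift_ge0 hl.
rewrite -EFinM lee_fin leNgt; apply/negP => hlD.
(* The three errors cost [e * (D + l + e + 1)], at most half of the gap [h - l * D]. What remains is
   x, the rate at which (number of points) times (largest weight) decays. *)
pose e := Num.min 1 ((h - l * D) / (2 * (D + l + 3))).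
have den : 0 < 2 * (D + l + 3) by lra.
have e0 : 0 < e by rewrite lt_min ltr01 divr_gt0 // subr_gt0.
have e1 : e <= 1 by rewrite ge_min lexx.
have e2 : e * (2 * (D + l + 3)) <= h - l * D.
  by rewrite -ler_pdivlMr // ge_min lexx orbT.
pose x := (h - e) - (D + e) * (l + e).
have x0 : 0 < x by rewrite /x; nra.
(* Three events of mass at least 7/8 meet in mass at least 1/2. *)
have d0 : 0 < 8^-1 :> R by [].
have [K hK] := mass_low_level d0.
have [N1 h1] := hl e _ e0 d0; have [N2 h2] := hh e _ e0 d0.
have [N3 h3] := hD e e0.
(* From this time on [e * n] exceeds [N3], so the growth estimate applies to the radius r below,
   even if l = 0. *)
pose N4 := (Num.truncn (N3%:R / e)).+1.
have [N5 h5] := exp_unbounded (2 * (K.+1%:R * expR ((D + e) * K%:R))) x0.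
pose n := maxn (maxn N1 N2) (maxn N4 N5).
have n1 : (N1 <= n)%N by rewrite /n !leq_max leqnn.
have n2 : (N2 <= n)%N by rewrite /n !leq_max leqnn orbT.
have n4 : (N4 <= n)%N by rewrite /n !leq_max leqnn !orbT.
have n5 : (N5 <= n)%N by rewrite /n !leq_max leqnn !orbT.
have n0 : 0 < n%:R :> R by rewrite ltr0n (leq_trans _ n4).
have hI1 := massI P0 Pnb P1 n o [set y | `|(rho o y)%:R / n%:R - l| < e]
  [set y | `|- (n%:R^-1 * ln (sp n o y)) - h| < e].
set A1 := _ `&` _ in hI1.
have hI2 := massI P0 Pnb P1 n o A1 [set y | (y.2 <= K)%N].
set A := A1 `&` _ in hI2.
have big : 2^-1 <= mass n o A.
  by have := h1 n n1; have := h2 n n2; have := hK n; lra.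
pose r := (Num.truncn ((l + e) * n%:R) + K)%N.
have le0 : 0 <= (l + e) * n%:R by rewrite mulr_ge0 // addr_ge0 // ltW.
pose D' := [fset y in reach nbs n o | y \in A]%fset.
have card : (size D' <= #|` orbit_ball r| * K.+1)%N.
  pose Z := [seq (g, k) | g <- orbit_ball r, k <- iota 0 K.+1].
  have <- : size Z = (#|` orbit_ball r| * K.+1)%N by rewrite size_allpairs size_iota.
  apply: uniq_leq_size; first exact: fset_uniq.
  move=> [g k]; rewrite !inE /= => /andP[_ /set_mem [[/= dy _] kK]].
  apply/allpairsP; exists (g, k); split; [|by rewrite mem_iota|by []].
  rewrite mem_orbit_ball.
  apply: (leq_trans (gdist_triangle cusp_connected (g, k) _ _)).
  apply: leq_add; last exact: leq_trans (gdist_le (cusp_joined_down g k)) kK.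
  rewrite truncn_ge_nat // -ler_pdivrMr //.
  by move: dy; rewrite ltr_norml => /andP[_]; rewrite /cusp_dist; lra.
have sub y : y \in A -> sp n o y <= expR (- ((h - e) * n%:R)).
  move=> /set_mem [[_ /= ey] _].
  (* Since [ln 0 = 0], points of probability zero are treated apart. *)
  have := step_prob_ge0 P0 Pnb n o y; rewrite le_eqVlt => /orP[/eqP <-|spy].
    by rewrite ltW // expR_gt0.
  rewrite -[leLHS](@lnK _ _ spy) ler_expR -mulNr -ler_pdivrMr // mulrC.
  by move: ey; rewrite ltr_norml => /andP[]; lra.
have up : mass n o A <= K.+1%:R * (#|` orbit_ball r|)%:R * expR (- ((h - e) * n%:R)).
  have -> : mass n o A = \sum_(y <- D') sp n o y by rewrite big_fset.
  apply: (@le_trans _ _ (\sum_(y <- D') expR (- ((h - e) * n%:R)))).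
    rewrite big_seq [leRHS]big_seq; apply: ler_sum => y.
    by rewrite !inE => /andP[_ yA]; exact: sub.
  rewrite big_const_seq count_predT iter_addr_0 -[_ *+ _]mulr_natl.
  by rewrite ler_wpM2r ?expR_ge0 // -natrM ler_nat mulnC.
have rN3 : (N3 <= r)%N.
  rewrite (leq_trans _ (leq_addr _ _)) // truncn_ge_nat //.
  have : N3%:R / e < n%:R by rewrite (lt_le_trans (truncnS_gt _)) // ler_nat.
  rewrite ltr_pdivrMr // => /ltW Nen; apply: le_trans Nen _.
  by rewrite mulrC ler_wpM2r ?ler0n // lerDr.
have rle : r%:R <= (l + e) * n%:R + K%:R.
  by rewrite natrD lerD2r truncn_le.
have bal : (#|` orbit_ball r|)%:R <= expR ((D + e) * ((l + e) * n%:R + K%:R)).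
  apply: le_trans (h3 r rN3) _; rewrite ler_expR ler_wpM2l // ltW //.
  by rewrite ltr_wpDl.
have := h5 n n5.
have EE : expR ((D + e) * ((l + e) * n%:R + K%:R)) * expR (- ((h - e) * n%:R)) =
    expR ((D + e) * K%:R) * expR (- (x * n%:R)).
  by rewrite -!expRD; congr expR; rewrite /x; ring.
have : 2^-1 <= K.+1%:R * (expR ((D + e) * K%:R) * expR (- (x * n%:R))).
  rewrite -EE mulrA; apply: le_trans big (le_trans up _).
  by rewrite ler_wpM2r ?expR_ge0 // ler_wpM2l.
rewrite expRN mulrA ler_pdivlMr ?expR_gt0 //.
by move: (expR (x * _)) (K.+1%:R * _) => u v; lra.
Qed.

(** For z = 1 + s, Carne's bound at distance [l * n / 2] is at most a constant times exp (s^2 n / 2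
    - s l n / 4). The exponent is best at s = l / 4; the cap 1 keeps [tilt_bounds] available. *)
Definition entropy_gap (l : R) := let s := Num.min 1 (l / 4) in s * (l / 2 - s) / 2.

Lemma entropy_gap_gt0 l : 0 < l -> 0 < entropy_gap l.
Proof.
move=> l0; rewrite /entropy_gap; set s := Num.min _ _.
have s0 : 0 < s by rewrite lt_min ltr01 divr_gt0.
have s1 : s <= l / 4 by rewrite ge_min lexx orbT.
by rewrite divr_gt0 // mulr_gt0 //; lra.
Qed.

Lemma measure_bounded : exists2 M, 0 < M & forall y, m y <= M.
Proof.
have [C [beta [C0 /andP[b0 b1] hC]]] := level_measure_decay.
have mm0 : 0 < m0 by exact: measure_gt0 o.
exists (m0 + C) => [|[g [|k]]]; first exact: addr_gt0.
  by rewrite /walk_measure /= lerDl ltW.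
apply: le_trans (hC k) _; apply: (@le_trans _ _ C); last by rewrite lerDr ltW.
by rewrite ler_piMr ?(ltW C0) // exprn_ile1 // ltW.
Qed.

(** The factor per unit of time costs only s^2 / 2, while the gain per unit of distance is linear in
    s; a small s therefore wins. The inverse of 1 + s is bounded by 1 - s + s^2, as (1 + s)(1 - s +
    s^2) = 1 + s^3. *)
Lemma tilt_bounds (s : R) : 0 <= s <= 1 ->
  (1 + s + (1 + s)^-1) / 2 <= expR (s ^+ 2 / 2) /\ expR (s / 2) <= 1 + s.
Proof.
move=> /andP[s0 s1]; have z0 : 0 < 1 + s by lra.
split.
  apply: le_trans (expR_ge1Dx _).
  have : (1 + s)^-1 <= 1 - s + s ^+ 2.
    by rewrite -[leLHS]mul1r ler_pdivrMr //; have := exprn_ge0 3 s0; nra.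
  by lra.
have h : 1 - s / 2 <= expR (- (s / 2)) by have := expR_ge1Dx (- (s / 2)); lra.
have e0 := expR_gt0 (s / 2).
have eN : expR (s / 2) * expR (- (s / 2)) = 1 by rewrite -expRD subrr expR0.
have := ler_wpM2l (ltW e0) h; rewrite eN => h2.
have : (1 + s) * (1 - s / 2) >= 1 by nra.
by nra.
Qed.

(** Boundedness of m controls the square root of m(y) / m(o) in Carne's inequality uniformly in
    y. *)
Lemma step_prob_decay l : 0 < l -> exists2 C, 0 < C & forall n y,
  l / 2 * n%:R <= (rho o y)%:R -> sp n o y <= C * expR (- (entropy_gap l * n%:R)).
Proof.
move=> l0; rewrite /entropy_gap; set s := Num.min _ _.
have s0 : 0 < s by rewrite lt_min ltr01 divr_gt0.
have s1 : s <= 1 by rewrite ge_min lexx.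
have [hc hz] : _ := @tilt_bounds s (ltac:(by rewrite ltW)).
have [M M0 hM] := measure_bounded.
have so : 0 < Num.sqrt (m o) by rewrite sqrtr_gt0 measure_gt0.
exists (Num.sqrt M / Num.sqrt (m o) * 2) => [|n y ny].
  by rewrite mulr_gt0 // divr_gt0 // sqrtr_gt0.
have z1 : 1 <= 1 + s by lra.
have z0 : 0 < 1 + s by lra.
have Prho u v : P u v != 0 -> (rho u y <= (rho v y).+1)%N.
  move=> /transition_adj uv; rewrite (leq_trans (gdist_triangle cusp_connected v u y)) //.
  by rewrite -add1n leq_add2r; exact: gdist_le (joined_by1 uv).
have := @carne_step_prob _ _ P nbs P0 Pnb P1 m measure_gt0 transition_reversible
  y (fun u => rho u y) (gdistxx _ y) Prho (1 + s) z1 n o.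
move=> /le_trans; apply; rewrite -!mulrA.
apply: (@le_trans _ _ (Num.sqrt M * ((Num.sqrt (m o))^-1 *
    (2 * (((1 + s + (1 + s)^-1) / 2) ^+ n / (1 + s) ^+ rho o y))))).
  apply: ler_wpM2r; last by apply: ler_wsqrtr.
  rewrite !mulr_ge0 ?invr_ge0 ?sqrtr_ge0 ?exprn_ge0 //; try by rewrite ltW.
  by rewrite mulr_ge0 // addr_ge0 ?invr_ge0 // ltW.
rewrite !ler_pM2l ?sqrtr_gt0 ?invr_gt0 //.
rewrite ler_pdivrMr ?exprn_gt0 //.
apply: (@le_trans _ _ (expR (s ^+ 2 / 2 * n%:R))).
  rewrite [s ^+ 2 / 2 * _]mulrC expRM_natl lerXn2r ?nnegrE ?expR_ge0 //.
  by rewrite mulr_ge0 // addr_ge0 ?invr_ge0 // ltW.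
apply: (@le_trans _ _ (expR (- (s * (l / 2 - s) / 2 * n%:R)) * expR (s / 2) ^+ rho o y)).
  rewrite -expRM_natl -expRD ler_expR.
  have : s / 2 * (l / 2 * n%:R) <= s / 2 * (rho o y)%:R by rewrite ler_wpM2l // divr_ge0 // ltW.
  by rewrite [(_)%:R * (s / 2)]mulrC; move: (rho o y)%:R (n%:R : R) => u v; lra.
by rewrite !mulrA ler_wpM2l ?expR_ge0 // lerXn2r ?nnegrE ?expR_ge0 // ltW.
Qed.

Lemma entropy_ge_gap l h : 0 < l -> drift_in_mass l -> entropy_in_mass h ->
  entropy_gap l <= h.
Proof.
move=> l0 hl hh; rewrite leNgt; apply/negP => hlt.
have [C C0 hC] := step_prob_decay l0.
(* Then h + e lies below the gap by e, and a point with typical distance and typical probability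
   would give exp (e n) < C. *)
pose e := (entropy_gap l - h) / 2.
have e0 : 0 < e by rewrite divr_gt0 // subr_gt0.
have l2 : 0 < l / 2 by rewrite divr_gt0.
have d0 : 0 < 4^-1 :> R by [].
have [N1 h1] := hl _ _ l2 d0; have [N2 h2] := hh e _ e0 d0.
have [N3 h3] := exp_unbounded C e0.
pose n := (maxn (maxn N1 N2) N3).+1.
have n1 : (N1 <= n)%N by rewrite leqW // !leq_max leqnn.
have n2 : (N2 <= n)%N by rewrite leqW // !leq_max leqnn orbT.
have n3 : (N3 <= n)%N by rewrite leqW // leq_max leqnn orbT.
have n0 : 0 < n%:R :> R by rewrite ltr0n.
have [y [/= dy ey spy]] := mass_meet (h1 n n1) (h2 n n2).
have := hC n y; rewrite -ler_pdivlMr // => /(_ _) up.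
have {}up : sp n o y <= C * expR (- (entropy_gap l * n%:R)).
  by apply: up; move: dy; rewrite ltr_norml => /andP[]; lra.
have low : expR (- ((h + e) * n%:R)) < sp n o y.
  rewrite -[ltRHS](@lnK _ _ spy) ltr_expR -mulNr -ltr_pdivlMr // mulrC.
  by move: ey; rewrite ltr_norml => /andP[]; lra.
have := lt_le_trans low up.
have -> : entropy_gap l * n%:R = e * n%:R + (h + e) * n%:R by rewrite /e; field.
rewrite opprD expRD mulrA -{1}[expR (- (_ * _))]mul1r ltr_pM2r ?expR_gt0 //.
rewrite expRN ltr_pdivlMr ?expR_gt0 // mul1r.
by have := h3 n n3; lra.
Qed.

Lemma chain_drift_in_mass (d : measure_display) (Omega : measurableType d)
    (Pr : G * nat -> probability Omega R) (Y : nat -> Omega -> G * nat) l :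
  markov_chain P Pr Y -> is_drift rho m Pr Y l -> drift_in_mass l.
Proof.
move=> ch dl eps delta e0 d0.
exact: (ae_cvg_mass P0 Pnb P1 ch o (f := fun n x y => (rho x y)%:R / n%:R)
  measure_gt0 e0 d0 dl).
Qed.

Lemma chain_entropy_in_mass (d : measure_display) (Omega : measurableType d)
    (Pr : G * nat -> probability Omega R) (Y : nat -> Omega -> G * nat) h :
  markov_chain P Pr Y -> is_entropy P m Pr Y h -> entropy_in_mass h.
Proof.
move=> ch eh eps delta e0 d0.
exact: (ae_cvg_mass P0 Pnb P1 ch o (f := fun n x y => - (n%:R^-1 * ln (sp n x y)))
  measure_gt0 e0 d0 eh).
Qed.

End CuspedWalk.

Theorem proposition7p2 (R : realType) (G : groupType) (H S : set G) (a : R)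
    (m0 pp : R) (p q c : nat -> R) (P : G * nat -> G * nat -> R)
    (hG : cusped_pair H S) (ha : 1 < a)
    (hpar : walk_parameters H S a m0 pp p q c)
    (hP : walk_transitions H S a m0 pp p q c P) :
  let m := walk_measure H S a m0 c in
  exists2 C : R, 0 < C &
    forall (d : measure_display) (Omega : measurableType d)
      (Pr : G * nat -> probability Omega R) (Y : nat -> Omega -> G * nat)
      (l h : R),
      markov_chain P Pr Y ->
      is_drift (cusp_dist H S a) m Pr Y l ->
      is_entropy P m Pr Y h ->
      l / C <= h /\ (h%:E <= l%:E * critical_exponent H S a)%E.
Proof.
move=> m.
(* The alternative concerns the kernel alone. If no positive value exists, every drift is at most 0,
   and C = 1 works because h is nonnegative. *)
have [[l0 [l0_gt0 hl0]]|no] := pselect (exists l0 : R, 0 < l0 /\ drift_in_mass H S a P l0).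
  exists (l0 / entropy_gap l0); first by rewrite divr_gt0 // entropy_gap_gt0.
  move=> d Omega Pr Y l h ch dl eh.
  have hl := chain_drift_in_mass hG ha hpar hP ch dl.
  have hh := chain_entropy_in_mass hG ha hpar hP ch eh.
  split; last exact: (entropy_le_growth hG ha hpar hP).
  rewrite (drift_unique hG ha hpar hP hl hl0).
  rewrite invf_div mulrCA mulfV ?lt0r_neq0 // mulr1.
  exact: (entropy_ge_gap hG ha hpar hP).
exists 1 => // d Omega Pr Y l h ch dl eh.
have hl := chain_drift_in_mass hG ha hpar hP ch dl.
have hh := chain_entropy_in_mass hG ha hpar hP ch eh.
split; last exact: (entropy_le_growth hG ha hpar hP).
rewrite divr1; apply: le_trans (entropy_ge0 hG ha hpar hP hh).
by rewrite leNgt; apply/negP => l_gt0; apply: no; exists l.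
Qed.
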